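(* Let $\mathfrak g=A(2k,2l)^{(4)}$, and for an integer $m$ write $\overline m=m\bmod 4$. For $m\neq0$, $$\dim\mathfrak g_{m\delta}=\begin{cases}k+l&\text{if }\overline m=0,\\ 1&\text{if }\overline m=1\text{ or }\overline m=3,\\ k+l+1&\text{if }\overline m=2,\ k\ne l,\\ 2k&\text{if }\overline m=2,\ k=l.\end{cases}$$
   Context: Everything is over $\mathbb C$. $A(2k,2l)^{(4)}$, with $k,l\ge0$, $(k,l)\neq(0,0)$, is the following twisted affine Lie superalgebra. Let $\dot{\mathfrak g}=\mathfrak{sl}(2k+1|2l+1)$ if $k\ne l$ and $\dot{\mathfrak g}=\mathfrak{psl}(2k+1|2k+1)$ if $k=l$, with Cartan subalgebra $\dot{\mathfrak h}$ and non-degenerate even invariant form $(-,-)$. Let $\sigma$ be the order $4$ automorphism of $\dot{\mathfrak g}$ preserving this form with $\dot{\mathfrak g}^\sigma\cong B(k|l)=\mathfrak{osp}(2k+1|2l)$; concretely, take a non-degenerate even bilinear form on $\mathbb C^{2k+1|2l+1}=\mathbb C^{2k+1|2l}\oplus\mathbb C^{0|1}$ that is the orthogonal sum of a supersymmetric form on $\mathbb C^{2k+1|2l}$ and a symmetric form on the odd line, and let $\sigma(X)$ be minus the super-adjoint of $X$ with respect to it, $\dot{\mathfrak h}$ being chosen $\sigma$-stable with $\dot{\mathfrak h}^\sigma=\dot{\mathfrak h}\cap\dot{\mathfrak g}^\sigma$ a Cartan subalgebra of $\dot{\mathfrak g}^\sigma$. Put $\dot{\mathfrak g}^j=\{x:\sigma(x)=i^jx\}$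 for $j\in\mathbb Z/4$ (where $i=\sqrt{-1}$). Then $$\mathfrak g=\bigoplus_{s\in\mathbb Z}\mathbb Ct^s\otimes\dot{\mathfrak g}^{\,s\bmod4}\oplus\mathbb CK\oplus\mathbb Cd,$$ with $K$ central, $[d,t^sa]=st^sa$, $[t^px,t^qy]=t^{p+q}[x,y]+p\,\delta_{p,-q}(x,y)K$. Its Cartan subalgebra is $\mathfrak h=\dot{\mathfrak h}^\sigma\oplus\mathbb CK\oplus\mathbb Cd$; $\delta\in\mathfrak h^*$ vanishes on $\dot{\mathfrak h}^\sigma\oplus\mathbb CK$ and $\delta(d)=1$; $\mathfrak g_{m\delta}=\{x\in\mathfrak g:[h,x]=m\delta(h)x\ \ \forall h\in\mathfrak h\}$. *)

(* Defs.v *)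
From HB Require Import structures.
From mathcomp Require Import all_boot all_order all_algebra.
From mathcomp Require Import ring_quotient.
From mathcomp Require Import complex.
From mathcomp Require Import boolp classical_sets functions cardinality.
From mathcomp Require Import finmap fsbigop reals ring zify.

Set Implicit Arguments.
Unset Strict Implicit.
Unset Printing Implicit Defensive.

Import Order.TTheory GRing.Theory Num.Theory.

Local Open Scope classical_set_scope.
Local Open Scope quotient_scope.
Local Open Scope ring_scope.

(* The quotient of a vector space by a subspace. *)
Section QuotientSpace.
Variables (F : fieldType) (V : vectType F) (W : {vspace V}).

Definition vquot : Type := {ideal_quot W}.

HB.instance Definition _ := GRing.Zmodule.on vquot.
HB.instance Definition _ :=
  ZmodQuotient.on vquot.

Definition vquot_scale (a : F) (x : vquot) : vquot := \pi_vquot (a *: repr x).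

Lemma eq_vquot (u v : V) : (u == v %[mod vquot]) = (u - v \in W).
Proof. by rewrite -Quotient.idealrBE. Qed.

Lemma pi_scale a (v : V) : \pi_vquot (a *: v) = vquot_scale a (\pi_vquot v).
Proof.
by apply/eqP; rewrite eq_vquot -scalerBr rpredZ // -eq_vquot reprK.
Qed.

Lemma vquot_scaleA a b x :
  vquot_scale a (vquot_scale b x) = vquot_scale (a * b) x.
Proof.
by elim/quotW: x => x; rewrite -(pi_scale b) -(pi_scale a) -pi_scale scalerA.
Qed.

Lemma vquot_scale1 : left_id 1 vquot_scale.
Proof. by elim/quotW => x; rewrite -pi_scale scale1r. Qed.

Lemma vquot_scaleDr : right_distributive vquot_scale +%R.
Proof.
move=> a; elim/quotW => x; elim/quotW => y.
by rewrite -raddfD -!pi_scale scalerDr raddfD.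
Qed.

Lemma vquot_scaleDl x : {morph vquot_scale^~ x : a b / a + b}.
Proof. by elim/quotW: x => x a b; rewrite -!pi_scale scalerDl raddfD. Qed.

HB.instance Definition _ := GRing.Zmodule_isLmodule.Build F vquot
  vquot_scaleA vquot_scale1 vquot_scaleDr vquot_scaleDl.

Lemma pi_vquot_linear : linear \pi_vquot.
Proof. by move=> a u v; rewrite raddfD; congr (_ + _); exact: pi_scale. Qed.

End QuotientSpace.

(* [S] is a linear subspace of dimension [n]. *)
Definition has_dim (F : fieldType) (V : lmodType F) (S : set V) (n : nat) :=
  exists b : 'I_n -> V,
    (forall a : 'I_n -> F, \sum_i a i *: b i = 0 -> forall i, a i = 0) /\
    S = [set x | exists a : 'I_n -> F, x = \sum_i a i *: b i].

Section GeneralLinear.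
Variables (C : numClosedFieldType) (p q : nat).
Implicit Types X Y : 'M[C]_(p + q).

(* gl(p|q): the first p basis vectors of C^(p|q) are even, the last q are odd. *)
Definition hpart (a : bool) X : 'M[C]_(p + q) :=
  if a then block_mx 0 (ursubmx X) (dlsubmx X) 0
  else block_mx (ulsubmx X) 0 0 (drsubmx X).

Definition gl_bracket X Y : 'M[C]_(p + q) :=
  \sum_(a : bool) \sum_(b : bool)
    (hpart a X *m hpart b Y - (-1) ^+ (a && b) *: (hpart b Y *m hpart a X)).

Definition str X : C := \tr (ulsubmx X) - \tr (drsubmx X).

Definition supertranspose X : 'M[C]_(p + q) :=
  block_mx (ulsubmx X)^T (dlsubmx X)^T (- (ursubmx X)^T) (drsubmx X)^T.

(* The super-adjoint X^* for the even form f(u, v) = u^T *m J *m v: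
   f(X u, v) = (-1)^(|X||u|) f(u, X^* v); see superadjointP below. *)
Definition superadjoint (J X : 'M[C]_(p + q)) : 'M[C]_(p + q) :=
  invmx J *m supertranspose X *m J.

Lemma gl_bracket_block a b c d a' b' c' d' :
  gl_bracket (block_mx a b c d) (block_mx a' b' c' d') =
  block_mx (a *m a' - a' *m a + b *m c' + b' *m c)
           (a *m b' + b *m d' - a' *m b - b' *m d)
           (c *m a' + d *m c' - c' *m a - d' *m c)
           (d *m d' - d' *m d + c *m b' + c' *m b).
Proof.
rewrite /gl_bracket !big_bool /= !(expr0, expr1, scale1r, scaleN1r, opprK).
rewrite /hpart !(block_mxKul, block_mxKur, block_mxKdl, block_mxKdr).
rewrite !mulmx_block !(mulmx0, mul0mx, addr0, add0r).
rewrite !(opp_block_mx, add_block_mx, oppr0, addr0, add0r).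
by congr block_mx; apply/matrixP => i j; rewrite !mxE; ring.
Qed.

Lemma str_block a b c d : str (block_mx a b c d) = \tr a - \tr d.
Proof. by rewrite /str block_mxKul block_mxKdr. Qed.

Lemma str_linear : scalar str.
Proof.
move=> a X Y; rewrite -(submxK X) -(submxK Y) scale_block_mx add_block_mx.
by rewrite !str_block !linearP /=; ring.
Qed.

HB.instance Definition _ :=
  GRing.isLinear.Build C 'M[C]_(p + q) C _ str str_linear.

Lemma str_bracket X Y : str (gl_bracket X Y) = 0.
Proof.
rewrite -(submxK X) -(submxK Y) gl_bracket_block str_block.
rewrite !(raddfD, raddfB) /=.
rewrite (mxtrace_mulC (ulsubmx X)) (mxtrace_mulC (drsubmx X)).
rewrite (mxtrace_mulC (ursubmx X)) (mxtrace_mulC (ursubmx Y)); ring.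
Qed.

Lemma gl_bracket_scalar X Y a b :
  gl_bracket (X + a%:M) (Y + b%:M) = gl_bracket X Y.
Proof.
rewrite -(submxK X) -(submxK Y) !scalar_mx_block !add_block_mx.
rewrite !gl_bracket_block !addr0.
rewrite !(mulmxDr, mulmxDl, mul_scalar_mx, mul_mx_scalar).
by congr block_mx; apply/matrixP => i j; rewrite !mxE; ring.
Qed.

Lemma gl_bracket_even X Y :
  hpart false X = X -> gl_bracket X Y = X *m Y - Y *m X.
Proof.
rewrite /hpart => Xev; rewrite -{2 3}Xev -(submxK X) -(submxK Y) gl_bracket_block.
move: (f_equal (@ursubmx _ _ _ _ _) Xev) (f_equal (@dlsubmx _ _ _ _ _) Xev).
rewrite block_mxKur block_mxKdl => <- <-.
rewrite !(block_mxKul, block_mxKur, block_mxKdl, block_mxKdr) !mulmx_block.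
rewrite opp_block_mx add_block_mx !(mulmx0, mul0mx, addr0, add0r, subr0).
by [].
Qed.

Lemma diag_even X : is_diag_mx X -> hpart false X = X.
Proof.
move=> /is_diag_mxP X0; rewrite -[in RHS](submxK X) /hpart.
by congr block_mx; apply/matrixP => i j; rewrite !mxE X0 //=;
  have := ltn_ord i; have := ltn_ord j; lia.
Qed.

Lemma gl_bracket_diag X Y i j :
  is_diag_mx X -> gl_bracket X Y i j = (X i i - X j j) * Y i j.
Proof.
move=> dX; rewrite gl_bracket_even ?diag_even //.
have /is_diag_mxP X0 := dX.
rewrite !mxE (bigD1 i) //= [X in _ + X - _]big1 => [|m mi]; last first.
  by rewrite X0 ?mul0r // eq_sym.
rewrite (bigD1 j) //= [X in _ - (_ + X)]big1 => [|m mj]; last first.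
  by rewrite X0 ?mulr0.
ring.
Qed.

Lemma strE X : str X = \sum_(i < p + q) (-1) ^+ (p <= i)%N * X i i.
Proof.
rewrite big_split_ord /= /str /mxtrace -sumrN; congr (_ + _).
  by apply: eq_bigr => i _; rewrite !mxE leqNgt ltn_ord mul1r.
by apply: eq_bigr => i _; rewrite !mxE leq_addr mulN1r.
Qed.

Lemma str_mul_delta X i j :
  str (X *m delta_mx i j) = (-1) ^+ (p <= j)%N * X j i.
Proof.
rewrite strE (bigD1 j) //= big1 => [|m mj]; last first.
  rewrite mxE big1 ?mulr0 // => n _.
  by rewrite mxE (negPf mj) andbF mulr0.
rewrite addr0 mxE (bigD1 i) //= big1 => [|n ni]; last first.
  by rewrite mxE (negPf ni) mulr0.
by rewrite mxE !eqxx mulr1 addr0.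
Qed.

Lemma superadjointP J X a b (u v : 'cV[C]_(p + q)) :
    J \in unitmx -> hpart a X = X ->
    (if b then usubmx u = 0 else dsubmx u = 0) ->
  (X *m u)^T *m J *m v =
    (-1) ^+ (a && b) *: (u^T *m J *m (superadjoint J X *m v)).
Proof.
move=> Ju Xa ub; rewrite /superadjoint !mulmxA.
rewrite -(mulmxA u^T) mulmxV // mulmx1 scalemxAl scalemxAl; congr (_ *m _ *m _).
rewrite trmx_mul scalemxAl -Xa -(vsubmxK u).
case: a b {Xa} ub => [] [] /= ->;
  rewrite /hpart /supertranspose !(block_mxKul, block_mxKur, block_mxKdl, block_mxKdr);
  rewrite tr_block_mx tr_col_mx !scale_row_mx !mul_row_block;
  rewrite !(trmx0, mulmx0, mul0mx, addr0, add0r, scaler0, expr0, expr1);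
  by rewrite ?(scale1r, scaleN1r, mulmxN, mulNmx, mulmx0, opprK, oppr0).
Qed.

End GeneralLinear.

Section FiniteDimensional.
Variables (C : numClosedFieldType) (k l : nat).

(* gl(2k+1|2l+1); the last basis vector spans the summand C^(0|1) of
   C^(2k+1|2l+1) = C^(2k+1|2l) + C^(0|1). *)
Local Notation gl := 'M[C]_(k.*2.+1 + (l.*2 + 1)).

(* The antidiagonal forms, for which the diagonal matrices are sigma-stable. *)
Definition gram_even : 'M[C]_(k.*2.+1) := \matrix_(i, j) (j == rev_ord i)%:R.

Definition gram_odd : 'M[C]_(l.*2) :=
  \matrix_(i, j) ((-1) ^+ (l <= i)%N * (j == rev_ord i)%:R).

Definition gram : gl := block_mx gram_even 0 0 (block_mx gram_odd 0 0 1%:M).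

(* -X^* for the form of Gram matrix gram. *)
Definition gl_sigma (X : gl) : gl := - superadjoint gram X.

Lemma gram_even_sym : gram_even^T = gram_even.
Proof. by apply/matrixP => i j; rewrite !mxE -(can_eq rev_ordK) rev_ordK eq_sym. Qed.

Lemma gram_even_sqr : gram_even *m gram_even = 1%:M.
Proof.
apply/matrixP => i j; rewrite !mxE (bigD1 (rev_ord i)) //= big1.
  by rewrite !mxE eqxx mul1r rev_ordK addr0 eq_sym.
by move=> m /negPf mi; rewrite !mxE mi mul0r.
Qed.

Lemma leq_rev_ord (i : 'I_(l.*2)) : (l <= rev_ord i)%N = ~~ (l <= i)%N.
Proof. rewrite /=; have := ltn_ord i; lia. Qed.

Lemma gram_odd_skew : gram_odd^T = - gram_odd.
Proof.
apply/matrixP => i j; rewrite !mxE -(can_eq rev_ordK) rev_ordK eq_sym.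
case: eqP => [->|_]; last by rewrite !mulr0 oppr0.
by rewrite leq_rev_ord; case: leqP; rewrite /= !(expr0, expr1, mulr1, opprK).
Qed.

Lemma gram_odd_sqr : gram_odd *m gram_odd = - 1%:M.
Proof.
apply/matrixP => i j; rewrite !mxE (bigD1 (rev_ord i)) //= big1.
  rewrite !mxE eqxx mulr1 rev_ordK addr0 eq_sym leq_rev_ord mulrA.
  by case: leqP => _ /=; rewrite !(expr0, expr1, mulr1, mul1r) ?mulN1r.
by move=> m /negPf mi; rewrite !mxE mi mulr0 mul0r.
Qed.

Definition gram_inv : gl :=
  block_mx gram_even 0 0 (block_mx (- gram_odd) 0 0 1%:M).

Lemma gramV : gram *m gram_inv = 1%:M.
Proof.
rewrite /gram /gram_inv !mulmx_block !(mulmx0, mul0mx, addr0, add0r, mulmx1).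
by rewrite mulmxN gram_even_sqr gram_odd_sqr opprK -!scalar_mx_block.
Qed.

Lemma gram_unit : gram \in unitmx.
Proof. by case: (mulmx1_unit gramV). Qed.

Lemma invmx_gram : invmx gram = gram_inv.
Proof. by rewrite -[RHS]mul1mx -(mulVmx gram_unit) -mulmxA gramV mulmx1. Qed.

Definition dgram : 'M[C]_(l.*2 + 1) := block_mx gram_odd 0 0 1%:M.
Definition dgram_inv : 'M[C]_(l.*2 + 1) := block_mx (- gram_odd) 0 0 1%:M.

Lemma dgramV : dgram *m dgram_inv = 1%:M.
Proof.
rewrite mulmx_block !(mulmx0, mul0mx, addr0, add0r, mulmx1).
by rewrite mulmxN gram_odd_sqr opprK -!scalar_mx_block.
Qed.

Lemma dgramVl : dgram_inv *m dgram = 1%:M.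
Proof. exact: mulmx1C dgramV. Qed.

Lemma gl_sigma_block a b c d : gl_sigma (block_mx a b c d) =
  block_mx (- (gram_even *m a^T *m gram_even))
           (- (gram_even *m c^T *m dgram))
           (dgram_inv *m b^T *m gram_even)
           (- (dgram_inv *m d^T *m dgram)).
Proof.
rewrite /gl_sigma /superadjoint invmx_gram /supertranspose.
rewrite !(block_mxKul, block_mxKur, block_mxKdl, block_mxKdr).
rewrite !mulmx_block !(mulmx0, mul0mx, addr0, add0r) opp_block_mx.
by rewrite mulmxN mulNmx opprK.
Qed.

Lemma gl_sigma_linear : linear gl_sigma.
Proof.
move=> a X Y; rewrite -(submxK X) -(submxK Y).
rewrite scale_block_mx add_block_mx !gl_sigma_block scale_block_mx add_block_mx.
congr block_mx; rewrite linearP /= ?(mulmxDr, mulmxDl) ?opprD;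
  by rewrite -!(scalemxAl, scalemxAr) ?scalerN.
Qed.

HB.instance Definition _ :=
  GRing.isLinear.Build C gl gl _ gl_sigma gl_sigma_linear.

Lemma str_sigma X : str (gl_sigma X) = - str X.
Proof.
rewrite -(submxK X) gl_sigma_block !str_block !raddfN /=.
rewrite -!mulmxA !(mxtrace_mulC _ (_ *m _)) -!mulmxA.
rewrite gram_even_sqr dgramV !mulmx1 !mxtrace_tr; ring.
Qed.

Lemma gl_sigma1 : gl_sigma 1%:M = - 1%:M.
Proof.
rewrite scalar_mx_block gl_sigma_block !(trmx1, trmx0, mulmx0, mul0mx, mulmx1).
by rewrite gram_even_sqr dgramVl opp_block_mx !oppr0.
Qed.

Lemma gl_sigma_bracket X Y :
  gl_sigma (gl_bracket X Y) = gl_bracket (gl_sigma X) (gl_sigma Y).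
Proof.
rewrite -(submxK X) -(submxK Y) gl_bracket_block !gl_sigma_block gl_bracket_block.
set S := gram_even; set J := dgram; set J' := dgram_inv.
have SK n (Z : 'M[C]_(_, n)) : S *m (S *m Z) = Z.
  by rewrite mulmxA gram_even_sqr mul1mx.
have JK n (Z : 'M[C]_(_, n)) : J *m (J' *m Z) = Z.
  by rewrite mulmxA dgramV mul1mx.
congr block_mx; rewrite !(raddfB, raddfD) /= !trmx_mul;
  rewrite !(mulmxDr, mulmxDl, mulmxBr, mulmxBl, mulmxN, mulNmx) -!mulmxA;
  rewrite ?(mulmxDr, mulmxDl, mulmxBr, mulmxBl, mulmxN, mulNmx) !(SK, JK);
  by apply/matrixP => i j; rewrite !mxE; ring.
Qed.

(* sigma^2 is conjugation by block_mx (- 1%:M) 0 0 flip. *)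
Definition flip : 'M[C]_(l.*2 + 1) := block_mx (- 1%:M) 0 0 1%:M.

Lemma flip_sqr : flip *m flip = 1%:M.
Proof.
rewrite mulmx_block !(mulmx0, mul0mx, addr0, add0r, mulmx1).
by rewrite mulNmx mul1mx opprK -scalar_mx_block.
Qed.

Lemma gl_sigma_sqr a b c d : gl_sigma (gl_sigma (block_mx a b c d)) =
  block_mx a (- (b *m flip)) (- (flip *m c)) (flip *m d *m flip).
Proof.
have trN n n' (A : 'M[C]_(n, n')) : (- A)^T = - A^T.
  by apply/matrixP => i j; rewrite !mxE.
have T : dgram_inv^T *m dgram = flip.
  rewrite /dgram_inv tr_block_mx !trmx0 trmx1 trN gram_odd_skew opprK.
  by rewrite mulmx_block !(mulmx0, mul0mx, addr0, add0r, mulmx1) gram_odd_sqr.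
have T' : dgram_inv *m dgram^T = flip.
  rewrite /dgram tr_block_mx !trmx0 trmx1 gram_odd_skew.
  rewrite mulmx_block !(mulmx0, mul0mx, addr0, add0r, mulmx1) mulmxN mulNmx.
  by rewrite opprK gram_odd_sqr.
rewrite !gl_sigma_block !(trN, trmx_mul) !trmxK !gram_even_sym.
congr block_mx; rewrite ?(mulmxN, mulNmx) ?opprK.
- by rewrite !mulmxA gram_even_sqr mul1mx -mulmxA gram_even_sqr mulmx1.
- by rewrite !mulmxA gram_even_sqr mul1mx -mulmxA T.
- by rewrite !mulmxA T' -mulmxA gram_even_sqr mulmx1.
by rewrite !mulmxA T' -!mulmxA T.
Qed.

Lemma gl_sigma_order4 X : gl_sigma (gl_sigma (gl_sigma (gl_sigma X))) = X.
Proof.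
rewrite -(submxK X) !gl_sigma_sqr ?(mulmxN, mulNmx) !opprK.
by rewrite !mulmxA flip_sqr !mul1mx -!mulmxA flip_sqr !mulmx1.
Qed.

Definition sl : {vspace gl} :=
  lker (linfun (@str C k.*2.+1 (l.*2 + 1) : gl -> C^o)).

Lemma mem_sl (X : gl) : (X \in sl) = (str X == 0).
Proof. by rewrite memv_ker lfunE. Qed.

(* The scalar matrices lie in sl exactly when k = l. *)
Definition scalars_sl : {vspace subvs_of sl} :=
  (linfun vsval @^-1: (if k == l then <[1%:M : gl]> else 0))%VS.

Lemma mem_scalars_sl (x : subvs_of sl) : (x \in scalars_sl) =
  (if k == l then is_scalar_mx (vsval x) else x == 0).
Proof.
rewrite -memv_preim lfunE /=; case: (k == l); last first.
  by rewrite memv0 -(inj_eq val_inj).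
apply/vlineP/is_scalar_mxP => -[a ->]; exists a; rewrite ?scalemx1 //.
Qed.

(* sl(2k+1|2l+1) if k <> l and psl(2k+1|2k+1) if k = l. *)
Definition gdot : Type := vquot scalars_sl.

HB.instance Definition _ := GRing.Lmodule.on gdot.
HB.instance Definition _ := ZmodQuotient.on gdot.

(* The structure that gl(2k+1|2l+1) induces on gdot; vsproj only restores the
   type of elements of sl, see the lemmas below. *)
Definition gdot_pi (X : gl) : gdot := \pi_gdot (vsproj sl X).
Definition gdot_repr (x : gdot) : gl := vsval (repr x).

Definition gdot_bracket (x y : gdot) : gdot :=
  gdot_pi (gl_bracket (gdot_repr x) (gdot_repr y)).

Definition gdot_form (x y : gdot) : C := str (gdot_repr x *m gdot_repr y).

Definition gdot_sigma (x : gdot) : gdot := gdot_pi (gl_sigma (gdot_repr x)).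

Lemma gdot_repr_sl x : gdot_repr x \in sl. Proof. exact: subvsP. Qed.

Lemma gdot_repr_str x : str (gdot_repr x) = 0.
Proof. by apply/eqP; rewrite -mem_sl gdot_repr_sl. Qed.

Lemma gdot_reprK x : gdot_pi (gdot_repr x) = x.
Proof. by rewrite /gdot_pi vsvalK reprK. Qed.

Lemma gdot_pi_linear : linear gdot_pi.
Proof. by move=> a X Y; rewrite /gdot_pi linearP pi_vquot_linear. Qed.

HB.instance Definition _ :=
  GRing.isLinear.Build C gl gdot _ gdot_pi gdot_pi_linear.

Lemma gdot_pi_eq0 X : X \in sl ->
  (gdot_pi X == 0) = (if k == l then is_scalar_mx X else X == 0).
Proof.
move=> Xsl.
have -> : gdot_pi X = \pi_gdot (Subvs Xsl).
  by congr (\pi_gdot _); apply: val_inj; rewrite /= vsprojK.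
rewrite -[0](raddf0 (\pi_gdot : subvs_of sl -> gdot)) eq_vquot subr0.
by rewrite mem_scalars_sl -(inj_eq val_inj).
Qed.


Lemma gdot_pi_scalar a : str (a%:M : gl) = 0 -> gdot_pi a%:M = 0.
Proof.
move=> a0; apply/eqP; rewrite gdot_pi_eq0 ?mem_sl ?a0 //.
case: eqP => [_|/eqP kl]; first exact: scalar_mx_is_scalar.
move/eqP: a0; rewrite scalar_mx_block str_block !mxtrace_scalar.
rewrite -(mulr_natr a k.*2.+1) -(mulr_natr a (_ + _)) -mulrBr.
rewrite mulf_eq0 => /orP[/eqP->|].
  by rewrite -scalar_mx_block -scalemx1 scale0r.
by rewrite subr_eq0 eqr_nat => /eqP kl'; case/eqP: kl; lia.
Qed.

Lemma gdot_piK X : X \in sl ->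
  exists2 a, str (a%:M : gl) = 0 & gdot_repr (gdot_pi X) = X + a%:M.
Proof.
move=> Xsl; set Y := gdot_repr _.
have YX : Y - X \in sl by rewrite rpredB ?gdot_repr_sl.
have /eqP : gdot_pi (Y - X) = 0 by rewrite raddfB /= gdot_reprK subrr.
rewrite gdot_pi_eq0 //; case: (k == l) => [/is_scalar_mxP[a Ea]|/eqP Ea].
  exists a; last by rewrite -Ea addrC subrK.
  by apply/eqP; rewrite -mem_sl -Ea.
exists 0; rewrite -scalemx1 scale0r ?raddf0 //.
by rewrite addr0; apply/eqP; rewrite -subr_eq0 Ea.
Qed.

Lemma gdot_bracket_pi X Y : X \in sl -> Y \in sl ->
  gdot_bracket (gdot_pi X) (gdot_pi Y) = gdot_pi (gl_bracket X Y).
Proof.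
move=> /gdot_piK[a _ Xa] /gdot_piK[b _ Yb]; rewrite /gdot_bracket Xa Yb.
by rewrite gl_bracket_scalar.
Qed.

Lemma gdot_form_pi X Y : X \in sl -> Y \in sl ->
  gdot_form (gdot_pi X) (gdot_pi Y) = str (X *m Y).
Proof.
rewrite !mem_sl => X0 Y0.
have [a a0 Xa] := gdot_piK (etrans (mem_sl X) X0).
have [b _ Yb] := gdot_piK (etrans (mem_sl Y) Y0).
rewrite /gdot_form Xa Yb mulmxDl !mulmxDr mul_scalar_mx mul_mx_scalar.
rewrite mul_mx_scalar !raddfD /= !linearZ /= a0 (eqP X0) (eqP Y0); ring.
Qed.

Lemma gl_sigma_sl X : X \in sl -> gl_sigma X \in sl.
Proof. by rewrite !mem_sl str_sigma oppr_eq0. Qed.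

Lemma gdot_sigma_pi X : X \in sl -> gdot_sigma (gdot_pi X) = gdot_pi (gl_sigma X).
Proof.
move=> /gdot_piK[a a0 Xa]; rewrite /gdot_sigma Xa raddfD raddfD /=.
have -> : gl_sigma a%:M = - a%:M.
  by rewrite -scalemx1 linearZ /= gl_sigma1 scalerN.
have -> : gdot_pi (- a%:M) = 0 by rewrite raddfN /= gdot_pi_scalar ?oppr0.
by rewrite addr0.
Qed.

Lemma gdot_sigma_bracket x y :
  gdot_sigma (gdot_bracket x y) = gdot_bracket (gdot_sigma x) (gdot_sigma y).
Proof.
rewrite gdot_sigma_pi ?mem_sl ?str_bracket // gl_sigma_bracket.
by rewrite gdot_bracket_pi ?gl_sigma_sl ?gdot_repr_sl.
Qed.

Lemma str_sigma_mul X Y : str (gl_sigma X *m gl_sigma Y) = str (X *m Y).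
Proof.
rewrite -(submxK X) -(submxK Y) !gl_sigma_block !mulmx_block !str_block.
set S := gram_even; set J := dgram; set J' := dgram_inv.
have SK n (Z : 'M[C]_(_, n)) : S *m (S *m Z) = Z.
  by rewrite mulmxA gram_even_sqr mul1mx.
have JK n (Z : 'M[C]_(_, n)) : J *m (J' *m Z) = Z.
  by rewrite mulmxA dgramV mul1mx.
rewrite !(mulNmx, mulmxN, opprK) -!mulmxA !(SK, JK) !(mxtraceD, raddfN) /=.
rewrite !(mxtrace_mulC S) !(mxtrace_mulC J') -!mulmxA.
rewrite !(gram_even_sqr, dgramV) !mulmx1 -!trmx_mul !mxtrace_tr.
rewrite (mxtrace_mulC (ulsubmx X)) (mxtrace_mulC (drsubmx X)).
rewrite (mxtrace_mulC (ursubmx X)) (mxtrace_mulC (dlsubmx X)); ring.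
Qed.


Lemma gdot_form_sigma x y : gdot_form (gdot_sigma x) (gdot_sigma y) = gdot_form x y.
Proof. by rewrite gdot_form_pi ?gl_sigma_sl ?gdot_repr_sl // str_sigma_mul. Qed.

(* The eigenspace for i^s, which depends only on s mod 4. *)
Definition gdot_part (s : int) : set gdot :=
  [set x | gdot_sigma x = ('i : C) ^ s *: x].

(* The classes of the diagonal matrices. *)
Definition hdot : set gdot := gdot_pi @` [set X | X \in sl /\ is_diag_mx X].

Definition hdot_sigma : set gdot := hdot `&` gdot_part 0.

Definition gdot_even : set gdot :=
  gdot_pi @` [set X | X \in sl /\ hpart false X = X].

Lemma hdot_abelian x y : hdot x -> hdot y -> gdot_bracket x y = 0.
Proof.
move=> [X [Xsl dX] <-] [Y [Ysl dY] <-]; rewrite gdot_bracket_pi //.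
suff -> : gl_bracket X Y = 0 by rewrite raddf0.
apply/matrixP => i j; rewrite gl_bracket_diag // mxE.
have [->|ij] := eqVneq i j; first by rewrite subrr mul0r.
by have /is_diag_mxP -> := dY; rewrite ?mulr0.
Qed.

Lemma gram_even_conj (A : 'M[C]_(k.*2.+1)) i j :
  (gram_even *m A *m gram_even) i j = A (rev_ord i) (rev_ord j).
Proof.
rewrite !mxE (bigD1 (rev_ord j)) //= big1 => [|n nj]; last first.
  by rewrite !mxE -(can_eq rev_ordK) rev_ordK eq_sym (negPf nj) mulr0.
rewrite !mxE rev_ordK eqxx mulr1 addr0 (bigD1 (rev_ord i)) //= big1.
  by rewrite !mxE eqxx mul1r addr0.
by move=> n /negPf ni; rewrite !mxE ni mul0r.
Qed.

Lemma gram_odd_conj (A : 'M[C]_(l.*2)) i j :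
  (gram_odd *m A *m gram_odd) i j =
  - (-1) ^+ ((l <= i)%N (+) (l <= j)%N) * A (rev_ord i) (rev_ord j).
Proof.
rewrite !mxE (bigD1 (rev_ord j)) //= big1 => [|n nj]; last first.
  by rewrite !mxE -(can_eq rev_ordK) rev_ordK eq_sym (negPf nj) !mulr0.
rewrite !mxE rev_ordK eqxx mulr1 addr0 (bigD1 (rev_ord i)) //= big1.
  rewrite !mxE eqxx mulr1 addr0 leq_rev_ord.
  by case: leqP => _; case: leqP => _ /=; rewrite !(expr0, expr1); ring.
by move=> n /negPf ni; rewrite !mxE ni mulr0 mul0r.
Qed.

Lemma dgram_conj a b c d :
  dgram_inv *m (block_mx a b c d)^T *m dgram =
  block_mx (- (gram_odd *m a^T *m gram_odd)) (- (gram_odd *m c^T))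
           (b^T *m gram_odd) d^T.
Proof.
rewrite tr_block_mx !mulmx_block !(mulmx0, mul0mx, addr0, add0r, mulmx1, mul1mx).
by rewrite !mulNmx.
Qed.

Lemma hdot_sigma_stable x : hdot x -> hdot (gdot_sigma x).
Proof.
move=> [X [Xsl dX] <-]; exists (gl_sigma X); last by rewrite gdot_sigma_pi.
split; first exact: gl_sigma_sl.
move: dX; rewrite -(submxK X) gl_sigma_block.
rewrite -[drsubmx X]submxK dgram_conj !is_diag_block_mx //.
case/and4P => /eqP-> /eqP-> /is_diag_mxP a0 /and4P[/eqP-> /eqP-> /is_diag_mxP d0 _].
rewrite opp_block_mx is_diag_block_mx // !(trmx0, mulmx0, mul0mx, oppr0, eqxx) /=.
rewrite opprK; apply/andP; split; first last.
  apply/andP; split; apply/is_diag_mxP => i j ij.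
    by rewrite gram_odd_conj [in X in _ * X]mxE d0 ?mulr0 //=;
      have := ltn_ord i; have := ltn_ord j; move: ij; lia.
  by rewrite !ord1 in ij.
apply/is_diag_mxP => i j ij; rewrite mxE gram_even_conj mxE a0 ?oppr0 //=.
by have := ltn_ord i; have := ltn_ord j; move: ij; lia.
Qed.

Definition coroot_even (a : 'I_(k.*2.+1)) : gl :=
  block_mx (delta_mx a a - delta_mx (rev_ord a) (rev_ord a)) 0 0 0.

Definition coroot_odd (b : 'I_(l.*2)) : gl :=
  block_mx 0 0 0
    (block_mx (delta_mx b b - delta_mx (rev_ord b) (rev_ord b)) 0 0 0).

Lemma sigma_fixed_sl X : gl_sigma X = X -> X \in sl.
Proof.
move=> sX; rewrite mem_sl; move/eqP: (str_sigma X).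
by rewrite sX -addr_eq0 -mulr2n mulrn_eq0.
Qed.

Lemma delta_diag n (a : 'I_n) : is_diag_mx (delta_mx a a : 'M[C]_n).
Proof.
apply/is_diag_mxP => i j ij; rewrite mxE; case: eqP => [ia|//].
by case: eqP => // ja; rewrite ia ja eqxx in ij.
Qed.

Lemma delta2_diag n (a b : 'I_n) :
  is_diag_mx (delta_mx a a - delta_mx b b : 'M[C]_n).
Proof.
apply/is_diag_mxP => i j ij; rewrite mxE [X in _ + X]mxE.
have /is_diag_mxP -> // := delta_diag a.
by have /is_diag_mxP -> // := delta_diag b; rewrite subr0.
Qed.

Lemma rev_ord_eq n (i a : 'I_n) : (rev_ord i == a) = (i == rev_ord a).
Proof. by rewrite -(can_eq rev_ordK) rev_ordK. Qed.

Lemma coroot_evenP a : is_diag_mx (coroot_even a) /\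
  gl_sigma (coroot_even a) = coroot_even a.
Proof.
split; first by rewrite is_diag_block_mx // !eqxx delta2_diag; apply/is_diag_mxP => *; rewrite mxE.
rewrite gl_sigma_block !(trmx0, mulmx0, mul0mx, oppr0); congr block_mx.
apply/matrixP => i j; rewrite mxE gram_even_conj !mxE !rev_ord_eq rev_ordK opprB.
by rewrite ![(j == _) && _]andbC.
Qed.

Lemma coroot_oddP b : is_diag_mx (coroot_odd b) /\
  gl_sigma (coroot_odd b) = coroot_odd b.
Proof.
split.
  rewrite !is_diag_block_mx // !eqxx delta2_diag /=; apply/andP; split;
  by apply/is_diag_mxP => *; rewrite mxE.
rewrite gl_sigma_block !(trmx0, mulmx0, mul0mx, oppr0); congr block_mx.
rewrite dgram_conj !(trmx0, mulmx0, mul0mx, oppr0) opp_block_mx !oppr0.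
congr block_mx; rewrite opprK; apply/matrixP => i j; rewrite gram_odd_conj.
have [->|ij] := eqVneq i j.
  by rewrite addbb !mxE !rev_ord_eq rev_ordK !andbb; ring.
have /is_diag_mxP d := delta2_diag b (rev_ord b).
by rewrite [in X in _ * X]mxE !d ?mulr0 // val_eqE ?(inj_eq rev_ord_inj) 1?eq_sym.
Qed.

Lemma hdot_sigma_sep (i j : 'I_(k.*2.+1 + (l.*2 + 1))) :
    i != j -> (k.*2.+1 <= i)%N = (k.*2.+1 <= j)%N ->
  exists2 H : gl, is_diag_mx H /\ gl_sigma H = H & H i i != H j j.
Proof.
have N11 : (-1 : C) != 1 by rewrite -subr_eq0 -opprD oppr_eq0 -mulr2n pnatr_eq0.
have N01 : (0 : C) != 1 by rewrite eq_sym oner_eq0.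
have N0N : (0 : C) != -1 by rewrite eq_sym oppr_eq0 oner_eq0.
case: (split_ordP i) => a ->; case: (split_ordP j) => b -> /= ab;
  rewrite ?leq_addr ?(leqNgt _ a) ?(leqNgt _ b) ?ltn_ord //= => _.
  rewrite (inj_eq (@lshift_inj _ _)) in ab.
  have [aa|aa] := eqVneq a (rev_ord a).
    have bb : b != rev_ord b.
      apply: contraNneq ab => bb; rewrite -val_eqE /=.
      move/(congr1 val): aa; move/(congr1 val): bb => /=.
      by have := ltn_ord a; have := ltn_ord b; lia.
    exists (coroot_even b); first exact: coroot_evenP.
    rewrite !block_mxEul !mxE (negPf ab) !eqxx (negPf bb) /= subr0.
    by rewrite -rev_ord_eq -aa (negPf ab) subr0.
  exists (coroot_even a); first exact: coroot_evenP.
  rewrite !block_mxEul !mxE !eqxx (negPf aa) (eq_sym b) (negPf ab) /= subr0 sub0r.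
  by case: (b == _); rewrite /= ?oppr0 ?oner_eq0 // eq_sym.
rewrite (inj_eq (@rshift_inj _ _)) in ab.
have rev_neq (c : 'I_(l.*2)) : c != rev_ord c.
  by apply/eqP => /(congr1 val) /=; have := ltn_ord c; lia.
case: (split_ordP a) ab => {}a ->; case: (split_ordP b) => {}b -> ab.
- rewrite (inj_eq (@lshift_inj _ _)) in ab.
  exists (coroot_odd a); first exact: coroot_oddP.
  rewrite !block_mxEdr !block_mxEul !mxE !eqxx (negPf (rev_neq a)) (eq_sym b).
  rewrite (negPf ab) /= subr0 sub0r.
  by case: (b == _); rewrite /= ?oppr0 ?oner_eq0 // eq_sym.
- exists (coroot_odd a); first exact: coroot_oddP.
  rewrite !block_mxEdr !block_mxEul !mxE !eqxx (negPf (rev_neq a)) /= subr0.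
  by rewrite oner_eq0.
- exists (coroot_odd b); first exact: coroot_oddP.
  by rewrite !block_mxEdr !block_mxEul !mxE !eqxx (negPf (rev_neq b)) /= subr0.
by rewrite !ord1 eqxx in ab.
Qed.

(* hdot and hdot_sigma are self-normalizing in the even parts of gdot and of
   its sigma-invariants, so they are Cartan subalgebras. *)
Lemma hdot_self_normalizing x : gdot_even x ->
  (forall h, hdot_sigma h -> hdot (gdot_bracket h x)) -> hdot x.
Proof.
move=> [X [Xsl Xev] <-] norm; exists X => //; split=> //.
apply/is_diag_mxP => i j ij.
have [pij|pij] := eqVneq (k.*2.+1 <= i)%N (k.*2.+1 <= j)%N; last first.
  rewrite -Xev; case: (split_ordP i) pij => a ->; case: (split_ordP j) => b -> /=;
    by rewrite ?block_mxEul ?block_mxEur ?block_mxEdl ?block_mxEdr ?mxE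
      // ?leq_addr ?(leqNgt _ a) ?(leqNgt _ b) ?ltn_ord.
have [H [dH sH] Hij] := hdot_sigma_sep ij pij.
have Hsl := sigma_fixed_sl sH.
have [|D [Dsl /is_diag_mxP dD]] := norm (gdot_pi H).
  by split; [exists H | rewrite /gdot_part /= gdot_sigma_pi // sH expr0z scale1r].
rewrite gdot_bracket_pi // => /eqP; rewrite -subr_eq0 -raddfB /=.
rewrite gdot_pi_eq0 ?rpredB ?mem_sl ?str_bracket //; last by rewrite -mem_sl.
move=> DH; have : (D - gl_bracket H X) i j = 0.
  case: (k == l) DH => [/is_scalar_mxP[c ->]|/eqP ->]; last by rewrite mxE.
  by rewrite mxE (negPf (ij : i != j)).
rewrite !mxE dD // gl_bracket_diag // add0r => /eqP.
by rewrite oppr_eq0 mulf_eq0 subr_eq0 (negPf Hij) /= => /eqP.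
Qed.

Lemma gdot_form_nondeg x : (forall y, gdot_form x y = 0) -> x = 0.
Proof.
set X := gdot_repr x => x0.
have X0 Y : str Y = 0 -> str (X *m Y) = 0.
  move/eqP; rewrite -mem_sl => Ysl; rewrite -(x0 (gdot_pi Y)).
  by rewrite -[x in RHS]gdot_reprK gdot_form_pi ?gdot_repr_sl.
have str_delta i j :
    str (delta_mx i j : gl) = (-1) ^+ (k.*2.+1 <= j)%N * (j == i)%:R.
  by rewrite -[delta_mx i j]mul1mx str_mul_delta mxE.
have sgn0 (b : bool) : (-1) ^+ b != 0 :> C by rewrite signr_eq0.
have Xoff i j : i != j -> X i j = 0.
  move=> ij; have := X0 (delta_mx j i).
  rewrite str_delta str_mul_delta (negPf ij) mulr0 => /(_ erefl)/eqP.
  by rewrite mulf_eq0 (negPf (sgn0 _)) => /eqP.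
pose o : 'I_(k.*2.+1 + (l.*2 + 1)) := lshift _ ord0.
have Xdiag i : X i i = X o o.
  have := X0 (- (-1) ^+ (k.*2.+1 <= i)%N *: delta_mx o o + delta_mx i i).
  rewrite mulmxDr -scalemxAr !str_linear !str_delta !str_mul_delta !eqxx /=.
  rewrite !mulr1 mul1r addNr => /(_ erefl)/eqP.
  by rewrite mulNr addrC -mulrBr mulf_eq0 (negPf (sgn0 _)) subr_eq0 => /eqP.
have XE : X = (X o o)%:M.
  apply/matrixP => i j; rewrite mxE.
  by case: eqVneq => [->|/Xoff ->]; rewrite ?mulr1n ?mulr0n.
by rewrite -[x]gdot_reprK -/X XE gdot_pi_scalar // -XE gdot_repr_str.
Qed.

(* (f, a, b) stands for the sum of the t^s f(s), plus a K + b d. *)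
Definition affine_ambient : Type := (int -> gdot) * C^o * C^o.

HB.instance Definition _ := GRing.Lmodule.on affine_ambient.

(* A(2k,2l)^(4). *)
Definition affine : set affine_ambient :=
  [set x | finite_set [set s | x.1.1 s != 0] /\
           forall s, gdot_part s (x.1.1 s)].

(* The sums run over the p where the summand is nonzero, which are finitely
   many on affine; see affine_bracket_tpow, affine_bracket_d, affine_bracket_K. *)
Definition affine_bracket (x y : affine_ambient) : affine_ambient :=
  let: (f, _, b) := x in let: (g, _, b') := y in
  (fun n => \sum_(p \in [set: int]) gdot_bracket (f p) (g (n - p))
            + (b * n%:~R) *: g n - (b' * n%:~R) *: f n,
   \sum_(p \in [set: int]) p%:~R * gdot_form (f p) (g (- p)),
   0).

Definition affine_cartan : set affine_ambient :=
  [set x | hdot_sigma (x.1.1 0) /\ forall s, s != 0 -> x.1.1 s = 0].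

Definition delta (x : affine_ambient) : C := x.2.

Definition root_space (alpha : affine_ambient -> C) : set affine_ambient :=
  [set x | affine x /\
    forall h, affine_cartan h -> affine_bracket h x = alpha h *: x].

(* t^s x, K and d. *)
Definition tpow (s : int) (x : gdot) : affine_ambient :=
  (fun n => if n == s then x else 0, 0, 0).
Definition Kelt : affine_ambient := (0, 1, 0).
Definition delt : affine_ambient := (0, 0, 1).

Lemma gdot_bracket0l y : gdot_bracket 0 y = 0.
Proof.
rewrite -(raddf0 gdot_pi) -[y]gdot_reprK gdot_bracket_pi ?rpred0 ?gdot_repr_sl //.
rewrite -[gdot_repr y]submxK -(block_mx0 C) gl_bracket_block.
by rewrite !(mulmx0, mul0mx, addr0, subr0).
Qed.

Lemma gdot_bracket0r x : gdot_bracket x 0 = 0.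
Proof.
rewrite -(raddf0 gdot_pi) -[x]gdot_reprK gdot_bracket_pi ?rpred0 ?gdot_repr_sl //.
rewrite -[gdot_repr x]submxK -(block_mx0 C) gl_bracket_block.
by rewrite !(mulmx0, mul0mx, addr0, subr0).
Qed.

Lemma gdot_form0l y : gdot_form 0 y = 0.
Proof.
rewrite -(raddf0 gdot_pi) -[y]gdot_reprK gdot_form_pi ?rpred0 ?gdot_repr_sl //.
by rewrite mul0mx raddf0.
Qed.

Lemma gdot_form0r x : gdot_form x 0 = 0.
Proof.
rewrite -(raddf0 gdot_pi) -[x]gdot_reprK gdot_form_pi ?rpred0 ?gdot_repr_sl //.
by rewrite mulmx0 raddf0.
Qed.

Lemma affine_bracket_tpow p q x y :
  affine_bracket (tpow p x) (tpow q y) =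
  tpow (p + q) (gdot_bracket x y)
  + ((p%:~R * (p == - q)%:R * gdot_form x y : C) *: Kelt).
Proof.
congr (_, _, _); last by rewrite /= scaler0 addr0.
  apply/funext => n /=; rewrite !mul0r !scale0r subr0 addr0.
  rewrite (fsbigTE [fset p]%fset) => [|r]; last first.
    by rewrite inE => /negPf ->; rewrite gdot_bracket0l.
  rewrite big_seq_fset1 eqxx subr_eq addrC.
  rewrite [RHS](_ : _ = if n == p + q then gdot_bracket x y else 0).
    by case: eqP => // _; rewrite gdot_bracket0r.
  by rewrite -[RHS]addr0; congr (_ + _); exact: scaler0.
rewrite (fsbigTE [fset p]%fset) => [|r]; last first.
  by rewrite inE => /negPf ->; rewrite gdot_form0l mulr0.
rewrite big_seq_fset1 eqxx /= add0r [RHS]mulr1 eqr_oppLR.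
by case: eqP => _; rewrite ?gdot_form0r !(mulr1, mulr0) ?mul0r.
Qed.

Lemma affine_bracket_d s x :
  affine_bracket delt (tpow s x) = (s%:~R : C) *: tpow s x.
Proof.
congr (_, _, _); rewrite /= ?scaler0 //.
  apply/funext => n /=.
  rewrite fsbig1 ?add0r => [|r _]; last by rewrite gdot_bracket0l.
  rewrite mul1r mul0r scale0r subr0.
  rewrite -[RHS]/(s%:~R *: (if n == s then x else 0)).
  by case: eqP => [->|_]; rewrite ?scaler0.
by rewrite fsbig1 // => r _; rewrite gdot_form0l mulr0.
Qed.

Lemma affine_bracket_K x : affine_bracket Kelt x = 0.
Proof.
case: x => [[f a] b]; congr (_, _, _).
  apply/funext => n /=.
  rewrite fsbig1 ?add0r => [|r _]; last by rewrite gdot_bracket0l.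
  by rewrite mul0r scale0r scaler0 subrr.
by rewrite fsbig1 // => r _; rewrite gdot_form0l mulr0.
Qed.

End FiniteDimensional.

(* Main.v *)
(* An element of weight m delta, m <> 0, is t^m y with y in the i^m-eigenspace of
   sigma commuting with the sigma-fixed diagonal matrices.  Such a y lifts to an
   i^m-eigenvector X of sigma in sl that still commutes with these matrices, so X
   is diagonal up to the two entries joining the even and the odd basis vector of
   weight 0.  As sigma^2 = -1 on these two entries and sigma^2 = 1 on the diagonal,
   odd m only sees the former (one line for each of i, -i), and even m the latter:
   the diagonals antisymmetric under the reversal for m = 0 mod 4, the symmetric
   ones with supertrace 0, modulo scalars when k = l, for m = 2 mod 4. *)
From HB Require Import structures.
Require Import Defs.
From mathcomp Require Import all_boot all_order all_algebra.
From mathcomp Require Import complex reals.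
From mathcomp Require Import boolp classical_sets functions cardinality fsbigop.
From mathcomp Require Import zify ring.

Import Order.TTheory GRing.Theory Num.Theory.

Local Open Scope ring_scope.

Set Implicit Arguments.
Unset Strict Implicit.
Unset Printing Implicit Defensive.

(** An injective linear map carries the standard basis to a basis of its range, so a dimension count
    amounts to a parametrisation by rows. *)
Lemma has_dim_range (F : fieldType) (V : lmodType F) (S : set V) n
    (L : 'rV[F]_n -> V) :
    linear L -> (forall a, L a = 0 -> a = 0) ->
  S = range L -> has_dim S n.
Proof.
move=> linL injL ->.
pose L' := GRing.isLinear.Build F _ _ _ L linL.
pose f : {linear 'rV[F]_n -> V} := HB.pack L L'.
have sumL (a : 'I_n -> F) :
    \sum_i a i *: L (delta_mx 0 i) = L (\row_i a i).
  rewrite -[RHS]/(f _) [\row_i a i]row_sum_delta linear_sum.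
  by apply: eq_bigr => i _; rewrite linearZ mxE.
exists (fun i => L (delta_mx 0 i)); split.
  move=> a; rewrite sumL => /injL/rowP a0 i.
  by have := a0 i; rewrite !mxE.
rewrite eqEsubset; split=> x /=.
  move=> [a _ <-]; exists (fun i => a 0 i).
  by rewrite sumL; congr L; apply/rowP => i; rewrite mxE.
by move=> [a ->]; exists (\row_i a i); rewrite ?sumL.
Qed.

Lemma oppr_id_eq0 (F : numDomainType) (x : F) : - x = x -> x = 0.
Proof.
by move/eqP; rewrite -subr_eq0 -opprD oppr_eq0 -mulr2n mulrn_eq0 => /eqP.
Qed.

Lemma one_neqN1 (F : numDomainType) : (1 : F) != -1.
Proof. by rewrite -addr_eq0 -mulr2n pnatr_eq0. Qed.

(** * Rows symmetric or antisymmetric under reversal of the indices *)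

Section FoldRow.
Variables (F : comPzRingType) (h n : nat).

(* [x] followed by [e] times its mirror image, with [p] in between; meaningful
   only for [h.*2 <= n]. *)
Definition foldrow (e : F) (x : 'rV[F]_h) (p : F) : 'rV[F]_n :=
  \row_i match insub (i : nat), insub (rev_ord i : nat) with
         | Some j, _ => x 0 j
         | None, Some j => e * x 0 j
         | None, None => p
         end.

Definition rev_row (a : 'rV[F]_n) : 'rV[F]_n := \row_i a 0 (rev_ord i).

Lemma foldrow_linear e c x y p q :
  foldrow e (c *: x + y) (c * p + q) = c *: foldrow e x p + foldrow e y q.
Proof.
apply/rowP => i; rewrite !mxE.
by case: insubP => [j _ _|_]; last case: insubP => [j _ _|_]; rewrite ?mxE //; ring.
Qed.

Lemma foldrow0_eq0 e x p : (h <= n)%N -> foldrow e x p = 0 -> x = 0.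
Proof.
move=> hn /rowP E; apply/rowP => j.
by have := E (widen_ord hn j); rewrite !mxE /= valK.
Qed.

(** Reversal exchanges the two halves, and [e * e = 1] makes the factor consistent. Middle positions
    go to middle positions, hence the alternative: no middle at all, or a middle value fixed by
    [e]. *)
Lemma rev_foldrow e x p : (h.*2 <= n)%N -> e * e = 1 ->
    ((n <= h.*2)%N \/ e * p = p) ->
  rev_row (foldrow e x p) = e *: foldrow e x p.
Proof.
move=> hn ee mid; apply/rowP => i; rewrite !mxE rev_ordK.
case: insubP => [j j1 jE|j1]; case: insubP => [j' j2 jE'|j2].
- by move: j1 j2 => /=; have := ltn_ord i; lia.
- by rewrite mulrA ee mul1r.
- by [].
by case: mid => [|->//]; move: j1 j2 => /=; have := ltn_ord i; lia.
Qed.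

(** The row [x] consists of the first [h] entries; the eigenvector equation then forces the last
    [h]. *)
Lemma rev_row_foldrow e a p : (h.*2 <= n)%N -> e * e = 1 ->
    rev_row a = e *: a ->
    (forall i : 'I_n, (h <= i)%N -> (h <= rev_ord i)%N -> a 0 i = p) ->
  exists x, a = foldrow e x p.
Proof.
move=> hn ee /rowP ae mid.
have hn' : (h <= n)%N by lia.
exists (\row_j a 0 (widen_ord hn' j)); apply/rowP => i; rewrite !mxE.
case: insubP => [j j1 jE|j1]; first by rewrite mxE; congr (a _ _); apply: val_inj.
case: insubP => [j' j2 jE'|j2]; last by apply: mid; rewrite leqNgt.
rewrite mxE; have -> : widen_ord hn' j' = rev_ord i by apply: val_inj.
by have := ae i; rewrite !mxE => ->; rewrite mulrA ee mul1r.
Qed.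

End FoldRow.

(** * Root spaces for multiples of delta in terms of [gdot] *)

Section RootSpace.
Variables (C : numClosedFieldType) (k l : nat).
Local Notation gl := 'M[C]_(k.*2.+1 + (l.*2 + 1)).
Local Notation gdot := (gdot C k l).
Local Notation affine_ambient := (affine_ambient C k l).

Lemma gdot_sigma0 : gdot_sigma (0 : gdot) = 0.
Proof.
by rewrite -(raddf0 (@gdot_pi C k l)) gdot_sigma_pi ?rpred0 ?raddf0.
Qed.

Lemma hdot_sigma0 : hdot_sigma (0 : gdot).
Proof.
split; last by rewrite /gdot_part /= gdot_sigma0 scaler0.
exists 0; last exact: raddf0.
by split; [exact: rpred0 | apply/is_diag_mxP => i j _; rewrite mxE].
Qed.

Lemma tpow_linear s : linear (@tpow C k l s).
Proof.
move=> c x y; congr (_, _, _); rewrite /= ?scaler0 ?addr0 //.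
apply/funext => n /=.
rewrite -[RHS]/(c *: (if n == s then x else 0) + (if n == s then y else 0)).
by case: eqP; rewrite ?scaler0 ?addr0.
Qed.

Lemma tpow_inj s : injective (@tpow C k l s).
Proof. by move=> x y [] /(congr1 (fun f => f s)); rewrite eqxx. Qed.

(** The element [d] multiplies the coefficient of [t^n] by [n] and kills the rest, so a weight with
    [m != 0] isolates the coefficient of [t^m]. The Cartan elements [t^0 h] then impose commutation
    with [hdot_sigma]. *)
Lemma root_space_mdelta (m : int) : m != 0 ->
  root_space (fun h : affine_ambient => m%:~R * delta h) =
  (@tpow C k l m @` [set y | gdot_part m y /\
     forall h, hdot_sigma h -> gdot_bracket h y = 0])%classic.
Proof.
move=> m0; have mC0 : (m%:~R : C) != 0 by rewrite intr_eq0.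
rewrite eqEsubset; split => -[[f a] b] /=.
  move=> [[_ fpart] root].
  have : affine_bracket (delt C k l) (f, a, b) = m%:~R * 1 *: (f, a, b).
    by apply: (root (delt C k l)); split => //=; exact: hdot_sigma0.
  rewrite mulr1 => -[fE aE bE].
  have {aE} a0 : a = 0.
    move: aE; rewrite fsbig1 => [/esym/eqP|p _]; last by rewrite gdot_form0l mulr0.
    by rewrite mulf_eq0 (negPf mC0) => /eqP.
  have {bE} b0 : b = 0.
    by move/esym/eqP: bE; rewrite mulf_eq0 (negPf mC0) => /eqP.
  have f0 n : n != m -> f n = 0.
    move=> nm; move/(congr1 (fun g => g n)): fE.
    rewrite fsbig1 => [|p _]; last by rewrite gdot_bracket0l.
    rewrite add0r scaler0 subr0 mul1r -[RHS]/(m%:~R *: f n) => /eqP.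
    rewrite -subr_eq0 -scalerBl -intrB.
    rewrite scaler_eq0 intr_eq0 subr_eq0 (negPf nm) /= => /eqP //.
  have xE : (f, a, b) = tpow m (f m).
    rewrite a0 b0; congr (_, _, _); apply/funext => n.
    by case: eqP => [->|/eqP/f0].
  exists (f m); last by rewrite -xE.
  split=> // h hh.
  (* On [t^0 h] the weight vanishes, so its bracket with [t^m (f m)] must be 0. *)
  have hc : affine_cartan (tpow 0 h) by split => //= s /negPf ->.
  have := root _ hc; rewrite xE affine_bracket_tpow.
  rewrite [delta _]/(0 : C) mulr0 scale0r mulr0z !mul0r scale0r addr0 add0r.
  by move=> /(congr1 (fun x => x.1.1 m)) /=; rewrite eqxx.
move=> [y [ypart ycent] [<- <- <-]]; split; first split => /=.
- apply: (sub_finite_set _ (finite_set1 m)) => s /=.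
  by have [//|_] := eqVneq s m; rewrite eqxx.
- move=> s; case: eqP => [->//|_].
  by rewrite /gdot_part /= gdot_sigma0 scaler0.
move=> [[g a'] b'] [/= g0 gn]; congr (_, _, _).
- apply/funext => n; rewrite fsbig1 => [|p _].
    rewrite mul0r scale0r subr0 add0r -[RHS]/(_ *: (if n == m then y else 0)).
    by case: eqP => [->|_]; rewrite ?scaler0 // mulrC.
  have [->|/gn ->] := eqVneq p 0; last by rewrite gdot_bracket0l.
  by rewrite subr0; case: eqP => _; rewrite ?ycent // gdot_bracket0r.
(* In the [K] coefficient only [p = 0] could contribute, and there the factor [p] vanishes. *)
- rewrite fsbig1 ?scaler0 // => p _.
  have [->|/gn ->] := eqVneq p 0; last by rewrite gdot_form0l mulr0.
  by rewrite mul0r.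
by rewrite scaler0.
Qed.


(** * Matrices of weight 0 for the sigma-fixed diagonal matrices *)

(** The two basis vectors of weight 0: [mid] is the only even index fixed by the reversal, and
    [last_odd] is the index of the summand [C^(0|1)]. *)
Definition mid : 'I_(k.*2.+1) := inord k.
Definition last_odd : 'I_(l.*2 + 1) := rshift l.*2 ord0.

(* The elements of gl of weight 0 for the sigma-fixed diagonal matrices: besides
   the diagonal ones, the products of the even and odd basis vectors of weight 0. *)
Definition weight0_mx (a : 'rV[C]_(k.*2.+1)) (be ga : C) (b : 'rV[C]_(l.*2))
    (w : C) : gl :=
  block_mx (diag_mx a) (be *: delta_mx mid last_odd)
           (ga *: delta_mx last_odd mid) (block_mx (diag_mx b) 0 0 w%:M).

Implicit Types (a : 'rV[C]_(k.*2.+1)) (b : 'rV[C]_(l.*2)) (be ga w : C).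

Lemma rev_mid : rev_ord mid = mid.
Proof. by apply: val_inj; rewrite /= inordK; lia. Qed.

Lemma mid_uniq (i : 'I_(k.*2.+1)) : i != mid -> i != rev_ord i.
Proof.
apply: contraNneq => /(congr1 val) /= iE.
by apply/eqP/val_inj; rewrite /= inordK; have := ltn_ord i; lia.
Qed.

Lemma rev_ord_neq (i : 'I_(l.*2)) : i != rev_ord i.
Proof. by apply/eqP => /(congr1 val) /=; have := ltn_ord i; lia. Qed.

Lemma weight0_mx_linear c a be ga b w a' be' ga' b' w' :
  weight0_mx (c *: a + a') (c * be + be') (c * ga + ga') (c *: b + b')
    (c * w + w') =
  c *: weight0_mx a be ga b w + weight0_mx a' be' ga' b' w'.
Proof.
rewrite /weight0_mx !scale_block_mx !add_block_mx !linearP !scaler0 !addr0 /=.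
by rewrite !scalerDl !scalerA scale_scalar_mx raddfD.
Qed.

Lemma weight0_mx_inj a be ga b w a' be' ga' b' w' :
    weight0_mx a be ga b w = weight0_mx a' be' ga' b' w' ->
  [/\ a = a', be = be', ga = ga', b = b' & w = w'].
Proof.
have diag_inj n : injective (@diag_mx C n).
  move=> u v /matrixP E; apply/rowP => i.
  by have := E i i; rewrite !mxE eqxx.
move=> /eq_block_mx[/diag_inj -> /matrixP E1 /matrixP E2].
move=> /eq_block_mx[/diag_inj -> _ _ /matrixP E3]; split=> //.
- by have := E1 mid last_odd; rewrite !mxE !eqxx !mulr1.
- by have := E2 last_odd mid; rewrite !mxE !eqxx !mulr1.
by have := E3 0 0; rewrite !mxE eqxx.
Qed.

Lemma weight0_mx0 : weight0_mx 0 0 0 0 0 = 0.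
Proof.
rewrite -[RHS](subrr (weight0_mx 0 0 0 0 0)) addrC -scaleN1r.
by rewrite -weight0_mx_linear !scaler0 !mulr0 !addr0.
Qed.

Lemma weight0_mxZ c a be ga b w :
  c *: weight0_mx a be ga b w =
  weight0_mx (c *: a) (c * be) (c * ga) (c *: b) (c * w).
Proof. by rewrite -[LHS]addr0 -weight0_mx0 -weight0_mx_linear !addr0. Qed.

Lemma weight0_mx_scalar c : weight0_mx (const_mx c) 0 0 (const_mx c) c = c%:M.
Proof.
by rewrite /weight0_mx !diag_const_mx !scale0r -!scalar_mx_block.
Qed.

Lemma str_weight0_mx a be ga b w :
  str (weight0_mx a be ga b w) = \sum_i a 0 i - \sum_i b 0 i - w.
Proof.
rewrite str_block mxtrace_diag mxtrace_block mxtrace_diag mxtrace_scalar.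
by rewrite mulr1n opprD addrA.
Qed.

(** This separates even from odd [m]: minus the reversal can only have the eigenvalues 1 and -1,
    while the quarter turn from [(be, ga)] to [(- ga, be)] has only ['i] and [- 'i]. *)
Lemma gl_sigma_weight0_mx a be ga b w :
  gl_sigma (weight0_mx a be ga b w) =
  weight0_mx (- rev_row a) (- ga) be (- rev_row b) (- w).
Proof.
have S_mid : gram_even C k *m delta_mx mid 0 = delta_mx mid 0 :> 'cV_ _.
  apply/colP => i; rewrite -colE !mxE eqxx andbT.
  by rewrite eq_sym rev_ord_eq rev_mid.
have mid_S : delta_mx 0 mid *m gram_even C k = delta_mx 0 mid :> 'rV_ _.
  by apply/rowP => i; rewrite -rowE !mxE rev_mid eqxx.
have last_J : delta_mx 0 last_odd *m dgram C l = delta_mx 0 last_odd :> 'rV_ _.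
  apply/rowP => i; rewrite -rowE mxE; case: (split_ordP i) => j ->.
    by rewrite block_mxEdl !mxE eqxx eq_lrshift.
  by rewrite block_mxEdr !mxE eqxx !ord1 !eqxx.
have J_last : dgram_inv C l *m delta_mx last_odd 0 = delta_mx last_odd 0 :> 'cV_ _.
  apply/colP => i; rewrite -colE mxE; case: (split_ordP i) => j ->.
    by rewrite block_mxEur !mxE eqxx eq_lrshift.
  by rewrite block_mxEdr !mxE eqxx !ord1 !eqxx.
(* Factoring a matrix unit as column times row lets each Gram matrix act on a basis vector of weight
   0, which it fixes. *)
have tr_delta p q (i : 'I_p) (j : 'I_q) :
    (delta_mx i j)^T = delta_mx j (0 : 'I_1) *m delta_mx 0 i :> 'M[C]_(q, p).
  by rewrite trmx_delta mul_delta_mx.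
rewrite gl_sigma_block; congr block_mx.
- rewrite tr_diag_mx; apply/matrixP => i j; rewrite mxE gram_even_conj !mxE.
  by rewrite (inj_eq rev_ord_inj) mulNrn.
- rewrite linearZ /= tr_delta -scalemxAr -scalemxAl !mulmxA S_mid -mulmxA last_J.
  by rewrite mul_delta_mx scaleNr.
- rewrite linearZ /= tr_delta -scalemxAr -scalemxAl !mulmxA J_last -mulmxA mid_S.
  by rewrite mul_delta_mx.
rewrite dgram_conj !trmx0 mulmx0 mul0mx tr_diag_mx tr_scalar_mx.
rewrite opp_block_mx !oppr0 -scalemx1 -scaleNr scalemx1; congr block_mx.
apply/matrixP => i j; rewrite opprK gram_odd_conj !mxE (inj_eq rev_ord_inj).
by case: eqVneq => [->|_]; rewrite ?addbb ?mulr0 // expr0 mulN1r mulr1n.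
Qed.

(** Bracketing with a diagonal [H] multiplies the entry at [(i, j)] by [H i i - H j j], so an entry
    survives only if no sigma-fixed [H] separates [i] from [j]. Distinct indices of equal parity are
    always separated; an even and an odd one are separated by a coroot unless they are [mid] and
    [last_odd]. *)
Lemma weight0_mxP (X : gl) :
    (forall H : gl, is_diag_mx H -> gl_sigma H = H -> gl_bracket H X = 0) ->
  exists a be ga b w, X = weight0_mx a be ga b w.
Proof.
move=> cent.
have X0 (H : gl) i j : is_diag_mx H -> gl_sigma H = H ->
    H i i != H j j -> X i j = 0.
  move=> dH sH Hij; have := congr1 (fun Z : gl => Z i j) (cent H dH sH).
  rewrite gl_bracket_diag // mxE => /eqP.
  by rewrite mulf_eq0 subr_eq0 (negPf Hij) /= => /eqP.
have Xpar (i j : 'I_(k.*2.+1 + (l.*2 + 1))) :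
    i != j -> (k.*2.+1 <= i)%N = (k.*2.+1 <= j)%N -> X i j = 0.
  move=> ij pij; have [H [dH sH] Hij] := hdot_sigma_sep C ij pij.
  exact: X0 dH sH Hij.
have Xmid i j : i != mid ->
    X (lshift _ i) (rshift _ j) = 0 /\ X (rshift _ j) (lshift _ i) = 0.
  move=> /mid_uniq im; have [dH sH] := coroot_evenP C l i.
  have Hii : coroot_even C l i (lshift _ i) (lshift _ i) = 1.
    by rewrite block_mxEul !mxE eqxx (negPf im) subr0.
  have Hjj : coroot_even C l i (rshift _ j) (rshift _ j) = 0.
    by rewrite block_mxEdr mxE.
  by split; apply: X0 dH sH _; rewrite Hii Hjj ?oner_eq0 // eq_sym oner_eq0.
have Xlast i (j : 'I_(l.*2)) :
    X (lshift _ i) (rshift _ (lshift 1 j)) = 0 /\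
    X (rshift _ (lshift 1 j)) (lshift _ i) = 0.
  have [dH sH] := coroot_oddP C k j.
  have Hii : coroot_odd C k j (lshift _ i) (lshift _ i) = 0.
    by rewrite block_mxEul mxE.
  have Hjj : coroot_odd C k j (rshift _ (lshift 1 j)) (rshift _ (lshift 1 j)) = 1.
    by rewrite block_mxEdr block_mxEul !mxE eqxx (negPf (rev_ord_neq j)) subr0.
  by split; apply: X0 dH sH _; rewrite Hii Hjj ?oner_eq0 // eq_sym oner_eq0.
exists (\row_i X (lshift _ i) (lshift _ i)), (X (lshift _ mid) (rshift _ last_odd)),
  (X (rshift _ last_odd) (lshift _ mid)),
  (\row_i X (rshift _ (lshift _ i)) (rshift _ (lshift _ i))),
  (X (rshift _ last_odd) (rshift _ last_odd)).
apply/matrixP => i j.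
case: (split_ordP i) => {}i ->; case: (split_ordP j) => {}j ->.
- rewrite block_mxEul !mxE; have [->//|ij] := eqVneq i j.
  rewrite mulr0n; apply: Xpar; first by rewrite (inj_eq (@lshift_inj _ _)).
  by rewrite /= ![(k.*2.+1 <= _)%N]leqNgt !ltn_ord.
- rewrite block_mxEur !mxE; have [->|im] := eqVneq i mid; last first.
    by rewrite (Xmid i j im).1 mulr0.
  case: (split_ordP j) => {}j ->; first by rewrite (Xlast mid j).1 eq_lrshift mulr0.
  by rewrite ord1 eqxx mulr1.
- rewrite block_mxEdl !mxE; have [->|jm] := eqVneq j mid; last first.
    by rewrite (Xmid j i jm).2 andbF mulr0.
  case: (split_ordP i) => {}i ->; first by rewrite (Xlast mid i).2 eq_lrshift mulr0.
  by rewrite ord1 eqxx mulr1.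
rewrite block_mxEdr.
have [<-|ij] := eqVneq i j.
  case: (split_ordP i) => {}i ->; first by rewrite block_mxEul !mxE eqxx.
  by rewrite block_mxEdr ord1 mxE eqxx.
rewrite (Xpar (rshift _ i) (rshift _ j)) /= ?leq_addr //; last first.
  by rewrite (inj_eq (@rshift_inj _ _)).
case: (split_ordP i) ij => {}i ->; case: (split_ordP j) => {}j ->;
  rewrite ?block_mxEul ?block_mxEur ?block_mxEdl ?block_mxEdr ?mxE //.
  by rewrite (inj_eq (@lshift_inj _ _)) => /negPf ->.
by rewrite !ord1 eqxx.
Qed.

Lemma diag_weight0_mx (H : gl) : is_diag_mx H ->
  exists a b w, H = weight0_mx a 0 0 b w.
Proof.
(* Diagonal matrices commute, so the classification of weight 0 matrices applies to [H] itself. *)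
move=> dH; have [|a [be [ga [b [w HE]]]]] := weight0_mxP (X := H).
  move=> H' dH' _; apply/matrixP => i j; rewrite gl_bracket_diag // mxE.
  have [->|ij] := eqVneq i j; first by rewrite subrr mul0r.
  by have /is_diag_mxP -> := dH; rewrite ?mulr0.
exists a, b, w; rewrite HE; congr weight0_mx.
  have := congr1 (fun Z : gl => Z (lshift _ mid) (rshift _ last_odd)) HE.
  rewrite block_mxEur !mxE !eqxx mulr1 => <-.
  have /is_diag_mxP -> // := dH; rewrite val_eqE.
  by rewrite eq_lrshift.
have := congr1 (fun Z : gl => Z (rshift _ last_odd) (lshift _ mid)) HE.
rewrite block_mxEdl !mxE !eqxx mulr1 => <-.
by have /is_diag_mxP -> // := dH; rewrite val_eqE eq_rlshift.
Qed.

(** A sigma-fixed diagonal matrix is antisymmetric under the reversal, hence 0 at [mid] and at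
    [last_odd], so it does not separate these two positions. *)
Lemma gl_bracket_weight0_mx (H : gl) a be ga b w :
  is_diag_mx H -> gl_sigma H = H -> gl_bracket H (weight0_mx a be ga b w) = 0.
Proof.
move=> dH sH; have [a' [b' [w' HE]]] := diag_weight0_mx dH.
move: sH; rewrite HE gl_sigma_weight0_mx => /weight0_mx_inj[aE _ _ _ wE].
have Hlast : H (rshift _ last_odd) (rshift _ last_odd) = 0.
  by rewrite HE !block_mxEdr mxE eqxx; exact: oppr_id_eq0.
have Hmid : H (lshift _ mid) (lshift _ mid) = 0.
  rewrite HE block_mxEul mxE eqxx; apply: oppr_id_eq0.
  by move/rowP: aE => /(_ mid); rewrite !mxE rev_mid.
rewrite -HE; apply/matrixP => i j; rewrite gl_bracket_diag // [RHS]mxE.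
have [->|ij] := eqVneq i j; first by rewrite subrr mul0r.
case: (split_ordP i) ij => {}i ->; case: (split_ordP j) => {}j ->.
- by rewrite block_mxEul mxE (inj_eq (@lshift_inj _ _)) => /negPf ->; rewrite mulr0.
- rewrite block_mxEur !mxE => _.
  have [->|_] := eqVneq i mid; last by rewrite !mulr0.
  have [->|_] := eqVneq j last_odd; last by rewrite !mulr0.
  by rewrite Hmid Hlast subrr mul0r.
- rewrite block_mxEdl !mxE => _; have [->|_] := eqVneq j mid; last first.
    by rewrite andbF !mulr0.
  have [->|_] := eqVneq i last_odd; last by rewrite !mulr0.
  by rewrite Hmid Hlast subrr mul0r.
rewrite block_mxEdr (inj_eq (@rshift_inj _ _)).
case: (split_ordP i) => {}i ->; case: (split_ordP j) => {}j ->;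
  rewrite ?block_mxEul ?block_mxEur ?block_mxEdl ?block_mxEdr ?mxE ?mulr0 //.
  by rewrite (inj_eq (@lshift_inj _ _)) => /negPf ->; rewrite mulr0.
by rewrite !ord1 eqxx.
Qed.

(** * Passing between eigenvectors in [gdot] and matrices in [sl] *)

Lemma gdot_piB (X Y : gl) : gdot_pi (X - Y) = gdot_pi X - gdot_pi Y.
Proof. exact: raddfB. Qed.

Lemma gdot_piZ c (X : gl) : gdot_pi (c *: X) = c *: gdot_pi X.
Proof. by rewrite -[c *: X]addr0 gdot_pi_linear raddf0 addr0. Qed.

(* If sigma X = z X + c, then X + c / (1 + z) lifts the class of X to an
   eigenvector; for z = -1 the relation sigma^4 = 1 forces c = 0. *)
Lemma gdot_part_lift (m : int) (y : gdot) : gdot_part m y ->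
  exists X : gl, [/\ X \in sl C k l, gdot_pi X = y & gl_sigma X = 'i ^ m *: X].
Proof.
rewrite /gdot_part /=; set z := 'i ^ m => ym.
pose X := gdot_repr y; have Xsl : X \in sl C k l := gdot_repr_sl y.
have XK : gdot_pi X = y := gdot_reprK y.
have sc c : gl_sigma c%:M = - c%:M :> gl.
  by rewrite -scalemx1 linearZ /= gl_sigma1 scalerN.
have [c strc sX] : exists2 c, str (c%:M : gl) = 0 & gl_sigma X = z *: X + c%:M.
  have Dsl : gl_sigma X - z *: X \in sl C k l.
    by rewrite rpredB ?rpredZ ?gl_sigma_sl.
  have : gdot_pi (gl_sigma X - z *: X) = 0.
    by rewrite gdot_piB gdot_piZ -gdot_sigma_pi // XK ym subrr.
  move/eqP; rewrite gdot_pi_eq0 //.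
  case: (k == l) => [/is_scalar_mxP[c cE]|/eqP D0].
    exists c; first by apply/eqP; rewrite -mem_sl -cE.
    by rewrite -cE addrC subrK.
  exists 0; first by rewrite raddf0 linear0.
  by rewrite raddf0 addr0; apply/eqP; rewrite -subr_eq0 D0.
have [z1|z1] := eqVneq (1 + z) 0.
  have zE : z = -1 by apply/eqP; rewrite -addr_eq0 addrC z1.
  exists X; split=> //; move: sX; rewrite zE scaleN1r => sX.
  have := gl_sigma_order4 X.
  (* Since sigma^2 fixes scalars, applying it twice subtracts [2c] twice, and sigma^4 = 1 gives
     [4c = 0]. *)
  have s2 : gl_sigma (gl_sigma X) = X + (- (c *+ 2))%:M.
    rewrite sX raddfD raddfN /= sX sc opprD opprK -addrA; congr (_ + _).
    by rewrite -opprD -raddfD -raddfN /= mulr2n.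
  have ss d : gl_sigma (gl_sigma d%:M) = d%:M :> gl by rewrite sc raddfN /= sc opprK.
  rewrite s2 [gl_sigma (X + _)]raddfD raddfD /= s2 ss -addrA -raddfD /=.
  move=> /eqP; rewrite -subr_eq0 addrAC subrr add0r -opprD -mulrnDr -scalemx1.
  rewrite scaler_eq0 oppr_eq0 mulrn_eq0 /= => /orP[/eqP c0|].
    by rewrite sX c0 raddf0 addr0.
  by move=> /eqP/matrixP/(_ 0 0)/eqP; rewrite !mxE oner_eq0.
have strc' : str ((c / (1 + z))%:M : gl) = 0.
  have -> : (c / (1 + z))%:M = (1 + z)^-1 *: c%:M :> gl.
    by rewrite scale_scalar_mx mulrC.
  by rewrite linearZ /= strc mulr0.
exists (X + (c / (1 + z))%:M); split.
- by rewrite rpredD // mem_sl strc'.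
- by rewrite raddfD /= XK gdot_pi_scalar ?addr0.
rewrite raddfD /= sX sc scalerDr -addrA; congr (_ + _).
rewrite scale_scalar_mx -raddfN -raddfD /=; congr _%:M.
by field.
Qed.

(** Reduces every residue to matrices: it suffices to give a linear family [L] of weight 0
    eigenvectors in [sl], with independent classes, that reaches the class of every such
    eigenvector. *)
Lemma has_dim_mdelta (m : int) n (L : 'rV[C]_n -> gl) : m != 0 -> linear L ->
    (forall x, [/\ L x \in sl C k l, gl_sigma (L x) = 'i ^ m *: L x &
       exists a be ga b w, L x = weight0_mx a be ga b w]) ->
    (forall x, gdot_pi (L x) = 0 -> x = 0) ->
    (forall a be ga b w (X := weight0_mx a be ga b w),
       X \in sl C k l -> gl_sigma X = 'i ^ m *: X ->
       exists x, gdot_pi X = gdot_pi (L x)) ->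
  has_dim (root_space (fun h : affine_ambient => m%:~R * delta h)) n.
Proof.
move=> m0 linL Lin Linj Lsurj.
apply: (@has_dim_range _ _ _ _ (fun x => tpow m (gdot_pi (L x)))).
- by move=> c x y; rewrite linL gdot_pi_linear tpow_linear.
- move=> x x0; apply/Linj/(@tpow_inj m).
  by rewrite x0; congr (_, _, _); apply/funext => s; case: ifP.
rewrite root_space_mdelta //; rewrite eqEsubset; split=> [_ [y [ypart ycent] <-]|].
  have [X [Xsl XK sX]] := gdot_part_lift ypart.
  have [|a [be [ga [b [w XE]]]]] := weight0_mxP (X := X).
    move=> H dH sH; have Hsl := sigma_fixed_sl sH.
    have := ycent (gdot_pi H).
    rewrite -XK gdot_bracket_pi // => /(_ _)/eqP.
    rewrite gdot_pi_eq0; last by rewrite mem_sl str_bracket.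
    have hH : hdot_sigma (gdot_pi H).
      split; first by exists H.
      by rewrite /gdot_part /= gdot_sigma_pi // sH expr0z scale1r.
    (* A bracket trivial in [gdot] is a scalar matrix or 0. Its diagonal vanishes because [H] is
       diagonal, and a scalar matrix has no other nonzero entries. *)
    move=> /(_ hH) E; apply/matrixP => i j; rewrite [RHS]mxE.
    have [<-|ij] := eqVneq i j; first by rewrite gl_bracket_diag // subrr mul0r.
    case: (k == l) E => [/is_scalar_mxP[c ->]|/eqP ->]; last by rewrite mxE.
    by rewrite mxE (negPf ij).
  rewrite XE in Xsl XK sX; have [x xE] := Lsurj _ _ _ _ _ Xsl sX.
  by exists x => //; rewrite -xE XK.
move=> _ [x _ <-]; have [Lsl sL [a [be [ga [b [w LE]]]]]] := Lin x.
exists (gdot_pi (L x)) => //; split.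
  by rewrite /gdot_part /= gdot_sigma_pi // sL gdot_piZ.
move=> h [[H [Hsl dH] HK] hs].
(* The representative [H] is sigma-fixed only modulo scalars; the class is lifted to a truly fixed
   [H'], which is diagonal because it differs from [H] by a scalar. *)
have [H' [H'sl H'K sH']] := gdot_part_lift hs.
rewrite expr0z scale1r in sH'.
have dH' : is_diag_mx H'.
  have : gdot_pi (H' - H) = 0 by rewrite gdot_piB H'K HK subrr.
  move/eqP; rewrite gdot_pi_eq0 ?rpredB // => E; apply/is_diag_mxP => i j ij.
  have : (H' - H) i j = 0.
    case: (k == l) E => [/is_scalar_mxP[c ->]|/eqP ->]; last by rewrite mxE.
    by rewrite mxE -val_eqE (negPf ij).
  have /is_diag_mxP H0 := dH.
  by rewrite !mxE H0 // subr0 => ->.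
by rewrite -H'K gdot_bracket_pi // LE gl_bracket_weight0_mx // raddf0.
Qed.

(** For [k = l] the kernel consists of scalar matrices, and the last entry [w = 0] leaves only the
    zero one. *)
Lemma gdot_pi_weight0_inj a be ga b (w : C) (X := weight0_mx a be ga b w) :
    X \in sl C k l -> gdot_pi X = 0 -> (k == l -> w = 0) -> X = 0.
Proof.
move=> Xsl /eqP; rewrite gdot_pi_eq0 //.
case: (k == l) => [/is_scalar_mxP[c XE] /(_ isT) w0|/eqP ->//].
move: XE; rewrite /X -weight0_mx_scalar => /weight0_mx_inj[-> -> -> -> wc].
by rewrite -wc w0 weight0_mx_scalar raddf0.
Qed.

(** * The eigenvector equations in weight 0 *)

Lemma expi_mod4 (m : int) : ('i : C) ^ m = 'i ^ (m %% 4)%Z.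
Proof.
have i4 : ('i : C) ^ (4 : int) = 1.
  by rewrite -exprnP (exprM _ 2 2) sqrCi sqrrN expr1n.
rewrite {1}(divz_eq m 4) expfzDr ?neq0Ci // [X in 'i ^ X * _]mulrC.
by rewrite -exprz_exp i4 exp1rz mul1r.
Qed.

(** Sigma negates the supertrace, so an eigenvector satisfies [(z + 1) * str X = 0]; only the
    eigenvalue -1 leaves a trace condition. *)
Lemma eigen_sl (X : gl) z : z != -1 -> gl_sigma X = z *: X -> X \in sl C k l.
Proof.
move=> z1 sX; have := str_sigma X; rewrite sX linearZ /= => /eqP.
rewrite -addr_eq0 -[X in _ + X]mul1r -mulrDl mulf_eq0 addr_eq0 (negPf z1) /=.
by rewrite mem_sl.
Qed.

Lemma gl_sigma_eigen_weight0 z a be ga b w :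
  gl_sigma (weight0_mx a be ga b w) = z *: weight0_mx a be ga b w <->
  [/\ rev_row a = (- z) *: a, - ga = z * be, be = z * ga,
     rev_row b = (- z) *: b & - w = z * w].
Proof.
rewrite gl_sigma_weight0_mx weight0_mxZ; split.
  move=> /weight0_mx_inj[aE gaE beE bE wE]; split=> //.
    by rewrite scaleNr -aE opprK.
  by rewrite scaleNr -bE opprK.
by move=> [-> -> <- -> ->]; rewrite !scaleNr !opprK.
Qed.

(** A quarter turn has square -1, so no eigenvalue of it squares to 1; this removes the off-diagonal
    entries for even [m]. *)
Lemma anti_eigen2 (z be ga : C) : z * z = 1 -> - ga = z * be -> be = z * ga ->
  be = 0 /\ ga = 0.
Proof.
move=> zz E1 E2.
have ga0 : ga = 0 by apply: oppr_id_eq0; rewrite E1 E2 mulrA zz mul1r.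
by rewrite E2 ga0 mulr0.
Qed.

Lemma between_halves (i : 'I_(k.*2.+1)) :
  (k <= i)%N -> (k <= rev_ord i)%N -> i = mid.
Proof.
move=> ki kri; apply: val_inj; rewrite /= inordK; last by lia.
by move: kri => /=; have := ltn_ord i; lia.
Qed.

Lemma rev_row_eigen e a b : e * e = 1 -> rev_row a = e *: a -> rev_row b = e *: b ->
  exists (x : 'rV_k) (y : 'rV_l), a = foldrow _ e x (a 0 mid) /\ b = foldrow _ e y 0.
Proof.
move=> ee aE bE.
have [||x ax] := @rev_row_foldrow _ k _ e a (a 0 mid) _ ee aE => //.
  by move=> i ki kri; rewrite (between_halves ki kri).
(* A row of even length [l.*2] has no middle entry, so 0 is a mere default value. *)
have [||y bY] := @rev_row_foldrow _ l _ e b 0 _ ee bE => //.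
  by move=> i /=; have := ltn_ord i; lia.
by exists x, y.
Qed.

(** * The residues 0, 1 and 3 modulo 4 *)

(** Eigenvalue 1 makes both diagonals antisymmetric, which kills the entry at [mid] and [w] and
    leaves [k] and [l] free entries. *)
Lemma has_dim_mdelta0 (m : int) : m != 0 -> (m %% 4)%Z = 0 ->
  has_dim (root_space (fun h : affine_ambient => m%:~R * delta h)) (k + l).
Proof.
move=> m0 m4; have zE : ('i : C) ^ m = 1 by rewrite expi_mod4 m4 expr0z.
have N1 : (-1 : C) * -1 = 1 by rewrite mulrNN mulr1.
pose L (x : 'rV[C]_(k + l)) : gl := weight0_mx (foldrow _ (-1) (lsubmx x) 0) 0 0
  (foldrow _ (-1) (rsubmx x) 0) 0.
have sL x : gl_sigma (L x) = 1 *: L x.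
  apply/gl_sigma_eigen_weight0; rewrite !mulr0 oppr0.
  by rewrite !rev_foldrow ?mulr0 //; [left | right].
have Lsl x : L x \in sl C k l := eigen_sl (one_neqN1 C) (sL x).
apply: (@has_dim_mdelta m (k + l) L m0).
- move=> c x y; rewrite /L -weight0_mx_linear -!foldrow_linear !linearP.
  by rewrite !mulr0 !addr0.
- by move=> x; rewrite zE; split; [| | do 5!eexists].
- move=> x /(gdot_pi_weight0_inj (Lsl x))-/(_ (fun=> erefl)).
  rewrite -weight0_mx0 => /weight0_mx_inj[Ek _ _ El _].
  rewrite -[x]hsubmxK (foldrow0_eq0 _ Ek) ?(foldrow0_eq0 _ El) ?row_mx0 //; lia.
move=> a be ga b w X Xsl; rewrite zE => /gl_sigma_eigen_weight0[aE gaE beE bE wE].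
have [be0 ga0] := anti_eigen2 (mulr1 1) gaE beE.
have w0 : w = 0 by apply: oppr_id_eq0; rewrite wE mul1r.
have a0 : a 0 mid = 0.
  apply: oppr_id_eq0; move/rowP: aE => /(_ mid).
  by rewrite !mxE rev_mid mulN1r => <-.
have [x [y [ax bY]]] := rev_row_eigen N1 aE bE.
exists (row_mx x y); congr gdot_pi.
by rewrite /X /L row_mxKl row_mxKr {1}ax a0 -bY be0 ga0 w0.
Qed.

(** The reversal squares to 1 but [- z] does not, so all diagonal entries vanish; [be] stays free
    and determines [ga] as [- z * be]. *)
Lemma has_dim_mdelta_odd (m : int) : m != 0 -> (m %% 4)%Z = 1 \/ (m %% 4)%Z = 3 ->
  has_dim (root_space (fun h : affine_ambient => m%:~R * delta h)) 1.
Proof.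
move=> m0 m4; set z : C := 'i ^ m.
have zz : z * z = -1.
  rewrite /z expi_mod4; case: m4 => ->; first by rewrite expr1z -expr2 sqrCi.
  by rewrite -exprnP -exprMn -expr2 sqrCi -signr_odd.
have NN1 : (- z) * (- z) != 1.
  by rewrite mulrNN zz eq_sym one_neqN1.
have z1 : z != -1.
  by apply: contraNneq NN1 => ->; rewrite opprK mulr1.
have z1' : 1 + z != 0 by rewrite addrC addr_eq0.
pose L (x : 'rV[C]_1) : gl := weight0_mx 0 (x 0 0) (- z * x 0 0) 0 0.
have rev0 n : rev_row (0 : 'rV[C]_n) = 0 by apply/rowP => i; rewrite !mxE.
have sL x : gl_sigma (L x) = z *: L x.
  apply/gl_sigma_eigen_weight0; rewrite !rev0 !scaler0 mulr0 oppr0.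
  by rewrite mulNr opprK mulrN mulrA zz mulN1r opprK.
have Lsl x : L x \in sl C k l := eigen_sl z1 (sL x).
have rev_eigen n (u : 'rV[C]_n) : rev_row u = - z *: u -> u = 0.
  move=> uE; have : (- z * - z) *: u = u.
    rewrite -scalerA -uE; move/rowP: uE => uE; apply/rowP => i.
    by have := uE (rev_ord i); rewrite !mxE rev_ordK => <-.
  move/eqP; rewrite -subr_eq0 -[X in _ - X]scale1r -scalerBl scaler_eq0.
  by rewrite subr_eq0 (negPf NN1) => /eqP.
apply: (@has_dim_mdelta m 1 L m0).
- move=> c x y; rewrite /L -weight0_mx_linear !scaler0 !mulr0 !addr0 !mxE.
  by congr weight0_mx; ring.
- by move=> x; split; [| | do 5!eexists].
- move=> x /(gdot_pi_weight0_inj (Lsl x))-/(_ (fun=> erefl)).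
  rewrite -weight0_mx0 => /weight0_mx_inj[_ x0 _ _ _].
  by apply/rowP => i; rewrite ord1 x0 mxE.
move=> a be ga b w X Xsl => /gl_sigma_eigen_weight0[aE gaE beE bE wE].
exists (const_mx be); congr gdot_pi; rewrite /X /L mxE.
rewrite (rev_eigen _ _ aE) (rev_eigen _ _ bE) mulNr -gaE opprK.
congr weight0_mx; apply/eqP; move/eqP: wE.
by rewrite eq_sym -subr_eq0 opprK addrC -{1}[w]mul1r -mulrDl mulf_eq0 (negPf z1').
Qed.

(** * The residue 2 modulo 4: symmetric diagonals of supertrace 0 *)

Section SigmaSymmetric.

Let sum_fold h n (x : 'rV[C]_h) := \sum_i foldrow n 1 x 0 0 i.

Lemma sum_foldrow (x : 'rV[C]_k) p :
  \sum_i foldrow k.*2.+1 1 x p 0 i = sum_fold k.*2.+1 x + p.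
Proof.
have -> : foldrow k.*2.+1 1 x p = foldrow _ 1 x 0 + p *: delta_mx 0 mid.
  have midK : mid = k :> nat by rewrite inordK //; lia.
  apply/rowP => i; rewrite !mxE eqxx /=.
  case: insubP => [j ik _|ki]; last case: insubP => [j ik _|ki'].
  - case: eqP => [iE|_]; last by rewrite mulr0 addr0.
    by move: ik; rewrite iE midK ltnn.
  - case: eqP => [iE|_]; last by rewrite mulr0 addr0.
    by exfalso; move: ik; rewrite iE /= midK; lia.
  rewrite -!leqNgt in ki ki'.
  by rewrite (between_halves ki ki') eqxx mulr1 add0r.
under eq_bigr do rewrite mxE.
rewrite big_split /=; congr (_ + _).
rewrite (bigD1 mid) //= big1 => [|i /negPf im]; last by rewrite !mxE im mulr0.
by rewrite !mxE !eqxx mulr1 addr0.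
Qed.

Let sum_fold_linear h n c (x y : 'rV[C]_h) :
  sum_fold n (c *: x + y) = c * sum_fold n x + sum_fold n y.
Proof.
rewrite mulr_sumr -big_split; apply: eq_bigr => i _ /=.
(* The middle value 0 is rewritten as [c * 0 + 0] to fit the joint linearity of [foldrow]. *)
by rewrite -{1}[0](addr0 (0 : C)) -{1}(mulr0 c) foldrow_linear !mxE.
Qed.

(* The middle entry makes the supertrace vanish. *)
Definition sigma_sym_mx (x : 'rV[C]_k) (y : 'rV[C]_l) (w : C) : gl :=
  weight0_mx (foldrow _ 1 x (w + sum_fold l.*2 y - sum_fold k.*2.+1 x)) 0 0
    (foldrow _ 1 y 0) w.

Lemma sigma_sym_mx_linear c x y w x' y' w' :
  sigma_sym_mx (c *: x + x') (c *: y + y') (c * w + w') =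
  c *: sigma_sym_mx x y w + sigma_sym_mx x' y' w'.
Proof.
rewrite /sigma_sym_mx -weight0_mx_linear -!foldrow_linear !sum_fold_linear.
rewrite !mulr0 !addr0; congr (weight0_mx (foldrow _ _ _ _)); ring.
Qed.

Lemma sigma_sym_mx_sl x y w : sigma_sym_mx x y w \in sl C k l.
Proof.
rewrite mem_sl str_weight0_mx sum_foldrow; apply/eqP; rewrite -/(sum_fold _ y).
ring.
Qed.

Lemma gl_sigma_sym_mx x y w :
  gl_sigma (sigma_sym_mx x y w) = -1 *: sigma_sym_mx x y w.
Proof.
apply/gl_sigma_eigen_weight0; rewrite !opprK !mulr0 oppr0 mulN1r.
by rewrite !rev_foldrow ?mulr1 //; [left | right; rewrite mul1r].
Qed.

Lemma sigma_sym_mx_eq0 x y w : sigma_sym_mx x y w = 0 -> [/\ x = 0, y = 0 & w = 0].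
Proof.
rewrite -weight0_mx0 => /weight0_mx_inj[Ek _ _ El ->]; split=> //.
  by apply: foldrow0_eq0 Ek; lia.
by apply: foldrow0_eq0 El; lia.
Qed.

(** Eigenvalue -1 makes the diagonals symmetric and leaves [w] free; the vanishing supertrace is
    then solved for the entry at [mid]. *)
Lemma sigma_sym_mx_surj a be ga b w (X := weight0_mx a be ga b w) :
    X \in sl C k l -> gl_sigma X = -1 *: X ->
  exists x y, X = sigma_sym_mx x y w.
Proof.
have N1 : (-1 : C) * -1 = 1 by rewrite mulrNN mulr1.
rewrite mem_sl str_weight0_mx => strX /gl_sigma_eigen_weight0[aE gaE beE bE wE].
have [be0 ga0] := anti_eigen2 N1 gaE beE.
rewrite opprK in aE bE.
have [x [y [ax bY]]] := rev_row_eigen (mulr1 1) aE bE.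
exists x, y; rewrite /X /sigma_sym_mx be0 ga0 -bY; congr weight0_mx.
rewrite {1}ax; congr foldrow; move: strX.
rewrite ax bY sum_foldrow -ax -/(sum_fold _ y) -addrA -opprD subr_eq0.
by move=> /eqP strX; rewrite [w + _]addrC -strX addrC addKr.
Qed.

(** The halves of the two diagonals give [k] and [l] parameters and [w] one more; for [k <> l] the
    projection from [sl] to [gdot] loses none of them. *)
Lemma has_dim_mdelta2_neq (m : int) : m != 0 -> (m %% 4)%Z = 2 -> k <> l ->
  has_dim (root_space (fun h : affine_ambient => m%:~R * delta h)) (k + l + 1).
Proof.
move=> m0 m4 /eqP/negPf kl.
have zE : ('i : C) ^ m = -1 by rewrite expi_mod4 m4 -exprnP sqrCi.
pose L (x : 'rV[C]_(k + l + 1)) : gl :=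
  sigma_sym_mx (lsubmx (lsubmx x)) (rsubmx (lsubmx x)) (rsubmx x 0 0).
apply: (@has_dim_mdelta m (k + l + 1) L m0).
- by move=> c x y; rewrite /L !linearP !mxE sigma_sym_mx_linear.
- by move=> x; rewrite zE; split;
    [exact: sigma_sym_mx_sl | exact: gl_sigma_sym_mx | do 5!eexists].
- move=> x /gdot_pi_weight0_inj-/(_ (sigma_sym_mx_sl _ _ _)).
  rewrite kl => /(_ _)/sigma_sym_mx_eq0[] // xl xr w0.
  rewrite -[x]hsubmxK -[lsubmx x]hsubmxK xl xr row_mx0.
  have -> : rsubmx x = 0 by apply/rowP => i; rewrite ord1 w0 mxE.
  by rewrite row_mx0.
move=> a be ga b w X Xsl; rewrite zE => sX.
have [x [y XE]] := sigma_sym_mx_surj Xsl sX.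
exists (row_mx (row_mx x y) (const_mx w)); congr gdot_pi.
by rewrite /L !row_mxKl !row_mxKr mxE.
Qed.

(** For [k = l] the identity lies in [sl], is itself an eigenvector for -1 and becomes 0 in [gdot];
    this costs the parameter [w]. *)
Lemma has_dim_mdelta2_eq (m : int) : m != 0 -> (m %% 4)%Z = 2 -> k = l ->
  has_dim (root_space (fun h : affine_ambient => m%:~R * delta h)) (k + l).
Proof.
move=> m0 m4 kl.
have zE : ('i : C) ^ m = -1 by rewrite expi_mod4 m4 -exprnP sqrCi.
have strS (c : C) : str (c%:M : gl) = 0.
  by rewrite scalar_mx_block str_block !mxtrace_scalar kl addn1 subrr.
pose L (x : 'rV[C]_(k + l)) : gl := sigma_sym_mx (lsubmx x) (rsubmx x) 0.
apply: (@has_dim_mdelta m (k + l) L m0).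
- move=> c x y; rewrite /L !linearP -sigma_sym_mx_linear.
  by rewrite mulr0 addr0.
- by move=> x; rewrite zE; split;
    [exact: sigma_sym_mx_sl | exact: gl_sigma_sym_mx | do 5!eexists].
- move=> x /gdot_pi_weight0_inj-/(_ (sigma_sym_mx_sl _ _ _) (fun=> erefl)).
  by move=> /sigma_sym_mx_eq0[xl xr _]; rewrite -[x]hsubmxK xl xr row_mx0.
move=> a be ga b w X Xsl; rewrite zE => sX.
(* Subtracting [w] times the identity changes neither the class nor the eigenvalue and makes the
   last entry 0. *)
pose X' := weight0_mx (- w *: const_mx 1 + a) be ga (- w *: const_mx 1 + b) 0.
have X'E : X' = - w *: 1%:M + X.
  by rewrite -weight0_mx_scalar -weight0_mx_linear !mulr0 !add0r mulr1 addNr.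
have X'sl : X' \in sl C k l.
  by rewrite X'E mem_sl str_linear strS mulr0 add0r -mem_sl.
have sX' : gl_sigma X' = -1 *: X'.
  by rewrite X'E gl_sigma_linear gl_sigma1 sX !scaleN1r scalerN opprD.
have [x [y X'L]] := sigma_sym_mx_surj X'sl sX'.
exists (row_mx x y); rewrite /L row_mxKl row_mxKr -X'L -/X' X'E gdot_pi_linear.
by rewrite gdot_pi_scalar // scaler0 add0r.
Qed.

End SigmaSymmetric.

End RootSpace.

Theorem corollary4p5p2 (R : realType) (k l : nat)
    (kl_neq0 : (k, l) <> (0%N, 0%N)) (m : int) (m_neq0 : m <> 0) :
  let g_mdelta : classical_sets.set (affine_ambient R[i] k l) :=
    root_space (fun h => m%:~R * delta h) in
  ((m %% 4)%Z = 0 -> has_dim g_mdelta (k + l)) /\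
  ((m %% 4)%Z = 1 \/ (m %% 4)%Z = 3 -> has_dim g_mdelta 1) /\
  ((m %% 4)%Z = 2 -> k <> l -> has_dim g_mdelta (k + l + 1)) /\
  ((m %% 4)%Z = 2 -> k = l -> has_dim g_mdelta (2 * k)).
Proof.
move/eqP: m_neq0 => m0 g_mdelta; do !split.
- exact: has_dim_mdelta0.
- exact: has_dim_mdelta_odd.
- exact: has_dim_mdelta2_neq.
move=> m2 kl; have -> : (2 * k = k + l)%N by lia.
exact: has_dim_mdelta2_eq.
Qed.
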